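(* For every $K\ge 1$ there are constants $C_1(K),C_2(K)>0$, depending only on $K$, such that the following holds. Let $G$ be a finite nilpotent group and $A\subset G$ a symmetric normal neighbourhood of the identity with $|A^3|\le K|A|$. Then there exist a (left and right) translation invariant pseudo-metric $\rho$ on $G$ and $\delta>0$ such that $B:=B(\rho,\delta)$ is a $C_1(K)$-dimensional ball, $A\subset B$, and $|B|\le C_2(K)|A|$.
   Context: For $A\subset G$, $A^3=\{abc:a,b,c\in A\}$. $A$ is a symmetric neighbourhood of the identity if $1_G\in A$ and $A=A^{-1}$; $A$ is normal if $xA=Ax$ for all $x\in G$. A pseudo-metric $\rho$ on $G$ (nonnegative, $\rho(x,x)=0$, symmetric, triangle inequality, possibly vanishing off the diagonal) is (left and right) translation invariant if $\rho(zx,zy)=\rho(x,y)=\rho(xz,yz)$ for all $x,y,z\in G$. $B(\rho,\delta):=\{x\in G:\rho(x,1_G)\le\delta\}$. A finite ball $B(\rho,\delta)$ with $\delta>0$ is $D$-dimensional if $|B(\rho,2\delta')|\le 2^D|B(\rho,\delta')|$ for all $\delta'\in(0,\delta]$. *)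

(* Defs.v *)
From mathcomp Require Import all_boot all_fingroup all_solvable.
From Stdlib Require Import Reals.

Set Implicit Arguments.
Unset Strict Implicit.
Unset Printing Implicit Defensive.

Definition pseudo_metric (T : Type) (rho : T -> T -> R) : Prop :=
  (forall x y, (0 <= rho x y)%R) /\
  (forall x, rho x x = 0%R) /\
  (forall x y, rho x y = rho y x) /\
  (forall x y z, (rho x z <= rho x y + rho y z)%R).

Definition bi_invariant (gT : finGroupType) (rho : gT -> gT -> R) : Prop :=
  forall x y z : gT, rho (z * x)%g (z * y)%g = rho x y /\
                     rho (x * z)%g (y * z)%g = rho x y.

Definition rball (gT : finGroupType) (rho : gT -> gT -> R) (delta : R) : {set gT} :=
  [set x : gT | if Rle_dec (rho x 1%g) delta then true else false].

Definition dimensional_ball (gT : finGroupType) (rho : gT -> gT -> R)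
    (delta D : R) : Prop :=
  (0 < delta)%R /\
  forall delta' : R, (0 < delta')%R -> (delta' <= delta)%R ->
    (INR #|rball rho (2 * delta')| <= Rpower 2 D * INR #|rball rho delta'|)%R.

(* Main.v *)
(* Let f = 1_A * 1_A.  By the Croot-Sisask sampling argument the bi-invariant distance
   |f(x .) - f|_1 has large balls S inside A^4.  A normal set acts by a scalar in every irreducible
   representation, so Bogolyubov's argument applies to class functions: with H the intersection of
   the kernels of the characters at which 1_A has large Fourier coefficient, H is contained in A^4,
   and these characters are nearly constant on S.

   Let E/H be a self-centralizing abelian normal subgroup of the nilpotent group G/H.  Sufficiently
   small S lies in E: for x in S the set L = [x, E]H is a subgroup of E on which the large characters
   are nearly constant.  If one of them is nontrivial on L, some group P generated by conjugates of L
   lies in A^4 without being negligible for it.  The constituents of that character on P all have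
   small multiplicity, so by a second moment computation it is far from its value at 1 on nearly all
   of P; but a positive proportion of P consists of elements close to 1, by covering.

   Hence SH is a normal set of small tripling in E with E/H abelian, and its large characters are
   linear.  Let B_j be the Bohr set where they satisfy |chi(x^(2^t)) - 1| <= 1/2 for all t <= j.
   Squaring maps B_(j+1) to B_j and pulls a covering of B_j by N pieces with differences in B_l back
   to one of B_(j+1) with differences in B_(l+1); so a single covering estimate at the top scale
   gives |B_j| <= N|B_(j+2)| at all scales.  The Birkhoff-Kakutani metric of the chain of the B_j,
   completed at the top by powers of A, is the required one. *)

Require Import Defs.
From mathcomp Require Import all_boot all_order all_algebra all_fingroup.
From mathcomp Require Import all_solvable all_field all_character.
From mathcomp Require Import zify ring boolp.

Set Implicit Arguments.
Unset Strict Implicit.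
Unset Printing Implicit Defensive.

(** * Products of sets *)

Section ProductSets.
Local Open Scope group_scope.
Variable gT : finGroupType.
Implicit Types (A S U V W X D : {set gT}) (x y : gT).

(** Fix one factorization x = u v of each [x] in [U * V]. The map sending (x, w) to (u w^-1, w v) is
    injective: the product of the two coordinates is x, which determines u and then w. *)
Lemma Ruzsa_triangle U V W : #|U * V| * #|W| <= #|U * W^-1| * #|W * V|.
Proof.
pose u x := odflt 1 [pick y in U | y^-1 * x \in V].
have uP x : x \in U * V -> u x \in U /\ (u x)^-1 * x \in V.
  case/mulsgP=> y z Uy Vz ->; rewrite /u; case: pickP => [y' /andP[] // | /(_ y)].
  by rewrite /= Uy mulKg Vz.
pose h (p : gT * gT) := (u p.1 * p.2^-1, p.2 * ((u p.1)^-1 * p.1)).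
rewrite -!cardsX -(card_in_imset (_ : {in setX (U * V) W &, injective h})).
  apply/subset_leq_card/subsetP => _ /imsetP[[x w] /setXP[/uP[Ux Vx] Ww] ->].
  by rewrite inE /= !mem_mulg // ?groupV ?mem_invg ?invgK.
move=> [x w] [x' w'] _ _ [] E1 E2.
have /= : (u x * w^-1) * (w * ((u x)^-1 * x)) = x by rewrite mulgA mulgKV mulKVg.
have : (u x' * w'^-1) * (w' * ((u x')^-1 * x')) = x' by rewrite mulgA mulgKV mulKVg.
rewrite -E1 -E2 => -> xx'; congr (_, _) => //.
by move: E1; rewrite -xx' => /mulgI/invg_inj.
Qed.

(** The triangle inequality with [U = A ^+ n], [V = A * A], [W = A] gives |A^(n+2)| |A| <= |A^(n+1)|
    |A^3|. *)
Lemma card_expgs K A : A^-1 = A -> 0 < #|A| -> #|A * A * A| <= K * #|A| ->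
  forall n, #|A ^+ n.+1| <= K ^ n * #|A|.
Proof.
move=> AV A_gt0 A3; elim=> [|n IHn]; first by rewrite mul1n.
rewrite -(leq_pmul2r A_gt0) expnS; apply: leq_trans (_ : #|A ^+ n.+1| * (K * #|A|) <= _).
  have -> : A ^+ n.+2 = A ^+ n * (A * A) by rewrite -[n.+2]addn2 expgD expgS expg1.
  apply: leq_trans (Ruzsa_triangle _ _ A) _.
  by rewrite AV -expgSr mulgA leq_mul2l A3 orbT.
apply: leq_trans (leq_mul IHn (leqnn _)) _.
by rewrite mulnCA !mulnA.
Qed.

(** Group the pairs (p, s) by their product. A fibre with base pair (p0, s0) embeds in the
    intersection on the right through p0^-1 p = s0 s^-1. *)
Lemma card_mulg_fiber (P : {group gT}) X : #|P| * #|X| <= #|P * X| * #|P :&: X * X^-1|.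
Proof.
have -> : (#|P| * #|X| =
    \sum_(z in (P * X)%g) #|[set q in setX P X | (q.1 * q.2)%g == z]|)%N.
  rewrite -cardsX -sum1_card (partition_big (fun q => q.1 * q.2) [in P * X]) /=.
    by apply: eq_bigr => z _; rewrite -sum1_card; apply: eq_bigl => q; rewrite !inE.
  by move=> [p s] /setXP[Pp Ss]; rewrite mem_mulg.
rewrite -sum_nat_const; apply: leq_sum => z _.
set Z := [set q in _ | _]; have [-> | [[p0 s0]]] := set_0Vmem Z; first by rewrite cards0.
rewrite !inE /= => /andP[/andP[Pp0 Xs0] /eqP zE].
pose h (q : gT * gT) := p0^-1 * q.1.
have injh : {in Z &, injective h}.
  move=> [p s] [p' s']; rewrite !inE /= => /andP[_ /eqP E] /andP[_ /eqP E'].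
  by rewrite /h /= => /mulgI Epp'; move: E; rewrite -E' Epp' => /mulgI ->.
rewrite -(card_in_imset injh); apply/subset_leq_card/subsetP => w /imsetP[[p s]].
rewrite !inE /= => /andP[/andP[Pp Xs] /eqP E] ->.
rewrite /h /= groupM ?groupV //=.
have -> : p0^-1 * p = s0 * s^-1.
  by apply: (mulgI p0); rewrite mulKVg mulgA zE -E mulgK.
by rewrite mem_mulg // mem_invg invgK.
Qed.

(* The fibres of c cut X into at most N pieces whose difference sets lie in D. *)
Definition splits (N : nat) X D : Prop :=
  exists c : gT -> gT, #|c @: X| <= N /\
    {in X &, forall x y, c x = c y -> x^-1 * y \in D}.

Lemma splits_card N X D : splits N X D -> #|X| <= N * #|D|.
Proof.
case=> c [cN cD]; apply: leq_trans (_ : #|c @: X| * #|D| <= _); last by rewrite leq_mul2r cN orbT.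
rewrite -sum1_card (partition_big c [in c @: X]) /= => [|x Xx]; last by rewrite imset_f.
rewrite -sum_nat_const; apply: leq_sum => z /imsetP[y Xy ->{z}].
rewrite sum1dep_card; set Z := [set x | _].
rewrite -(card_imset _ (mulgI y^-1)); apply/subset_leq_card/subsetP => w /imsetP[x].
by rewrite inE => /andP[Xx /eqP cE] ->; apply: cD.
Qed.

(** The labelling is pulled back along squaring; this is what carries one covering estimate through
    all scales of Bohr sets. *)
Lemma splits_sqr N X D X' D' : splits N X D ->
    {in X', forall x, x ^+ 2 \in X} ->
    {in X' &, forall x y, (x ^+ 2)^-1 * y ^+ 2 \in D -> x^-1 * y \in D'} ->
  splits N X' D'.
Proof.
case=> c [cN cD] XX' DD'; exists (fun x => c (x ^+ 2)); split.
  apply: leq_trans cN; apply/subset_leq_card/subsetP => _ /imsetP[x X'x ->].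
  by rewrite imset_f ?XX'.
by move=> x y X'x X'y /(cD _ _ (XX' x X'x) (XX' y X'y)); apply: DD'.
Qed.

(** A maximal [Y] in [X] with pairwise disjoint translates y S has at most [N] elements, as these
    translates lie in [X * S]. By maximality every [x] lies in y S S^-1 for some y in [Y], which
    becomes its label. *)
Lemma Ruzsa_covering N X S : 0 < #|S| -> #|X * S| <= N * #|S| ->
  splits N X (S * S^-1 * (S * S^-1)).
Proof.
move=> S_gt0 XS.
pose sep (Y : {set gT}) := (Y \subset X) &&
  [forall y in Y, forall z in Y, (y^-1 * z \in S * S^-1) ==> (y == z)].
have sep0 : sep set0.
  by rewrite /sep sub0set; apply/forall_inP => y; rewrite inE.
have [Y /maxsetP[/andP[sYX /forall_inP sepY] maxY] _] := maxset_exists sep0.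
have {}sepY : {in Y &, forall y z, y^-1 * z \in S * S^-1 -> y = z}.
  by move=> y z Yy Yz yz; have /forall_inP/(_ z Yz)/implyP/(_ yz)/eqP := sepY y Yy.
have SS1 : 1 \in S * S^-1.
  have [s Ss] : exists s, s \in S by apply/set0Pn; rewrite -card_gt0.
  by rewrite -(mulgV s) mem_mulg // mem_invg invgK.
have SSV x : (x^-1 \in S * S^-1) = (x \in S * S^-1) by rewrite -mem_invg invMg invgK.
pose c x := odflt 1 [pick y in Y | y^-1 * x \in S * S^-1].
have cP x : x \in X -> c x \in Y /\ (c x)^-1 * x \in S * S^-1.
  move=> Xx; rewrite /c; case: pickP => [y /andP[] // | nY]; exfalso.
  have nYx : x \notin Y by apply/negP => Yx; have := nY x; rewrite /= Yx mulVg SS1.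
  case/negP: nYx; rewrite -(maxY (x |: Y)) ?subsetUr ?setU11 //.
  rewrite /sep subUset sub1set Xx sYX; apply/forall_inP => y /setU1P Yy.
  apply/forall_inP => z /setU1P Yz; apply/implyP => yz.
  case: Yy Yz yz => [-> | Yy] [-> | Yz] //.
  - by rewrite -SSV invMg invgK => yz; have := nY z; rewrite /= Yz yz.
  - by move=> yz; have := nY y; rewrite /= Yy yz.
  by move/(sepY _ _ Yy Yz) => ->.
exists c; split; last first.
  move=> x y Xx Xy cE; have [_ cx] := cP x Xx; have [_ cy] := cP y Xy.
  rewrite -[x^-1 * y](_ : ((c x)^-1 * x)^-1 * ((c y)^-1 * y) = _).
    by rewrite mem_mulg // SSV.
  by rewrite invMg invgK cE -mulgA mulKVg.
apply: leq_trans (_ : #|Y| <= N).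
  by apply/subset_leq_card/subsetP => _ /imsetP[x /cP[Yx _] ->].
rewrite -(leq_pmul2r S_gt0); apply: leq_trans XS; rewrite -cardsX.
have inj : {in setX Y S &, injective (fun q : gT * gT => q.1 * q.2)}.
  move=> [y s] [y' s'] /setXP[Yy Ss] /setXP[Yy' Ss'] /= E.
  have yy' : y = y'.
    apply: sepY => //; rewrite (_ : y^-1 * y' = s * s'^-1) ?mem_mulg ?mem_invg ?invgK //.
    by apply: (mulgI y); rewrite mulKVg mulgA E mulgK.
  by move: E; rewrite yy' => /mulgI ->.
rewrite -(card_in_imset inj); apply/subset_leq_card/subsetP => w /imsetP[[y s]].
by case/setXP => Yy Ss ->; rewrite mem_mulg // (subsetP sYX).
Qed.

End ProductSets.

(** * Self-centralizing abelian normal subgroups of nilpotent groups *)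

Section SelfCentralizing.
Local Open Scope group_scope.

(** Otherwise ['C_G(A) / A] is a nontrivial normal subgroup of a nilpotent group, hence meets the
    centre. Adjoining to [A] a preimage [z] of a nontrivial common element gives a larger abelian
    normal subgroup. *)
Lemma nil_max_abelian_cent (gT : finGroupType) (G A : {group gT}) :
  nilpotent G -> [max A | (A <| G) && abelian A] -> 'C_G(A) \subset A.
Proof.
move=> nilG /maxgroupP[/andP[nsAG cAA] maxA].
have nsCG : 'C_G(A) <| G by rewrite /normal subsetIl normsI ?normG ?norms_cent ?normal_norm.
apply/negPn/negP => nsCA.
have nAC : 'C_G(A) \subset 'N(A) by rewrite subIset // normal_norm.
have ntC : 'C_G(A) / A != 1 by apply: contraNneq nsCA => C1; rewrite -quotient_sub1 ?C1.
have := meet_center_nil (quotient_nil A nilG) (quotient_normal A nsCG) ntC.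
case/trivgPn => _ /setIP[/morphimP[z Nz Cz ->] Zz] ntz.
have /setIP[Gz cAz] := Cz.
have nzA : z \notin A by apply: contraNN ntz => Az; rewrite /= coset_id.
pose B := (A <*> <[z]>)%G.
have cBB : abelian B by rewrite abelianY cAA cycle_abelian /= cycle_subG.
have nsBG : B <| G.
  rewrite /normal join_subG (normal_sub nsAG) cycle_subG Gz /=.
  apply/subsetP => g Gg; rewrite inE -genJ gen_subG conjUg subUset.
  have /normsP/(_ g Gg) -> := normal_norm nsAG.
  rewrite joing_subl -cycleJ cycle_subG /=.
  have Ng : g \in 'N(A) by apply: subsetP Gg; apply: normal_norm.
  have Azg : [~ z, g] \in A.
    apply: coset_idr; rewrite ?groupR // morphR //=; apply/eqP/commgP.
    case/setIP: Zz => _ /centP; apply; exact: mem_quotient.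
  rewrite conjg_mulR groupM //; last by rewrite (subsetP (joing_subl _ _)).
  by rewrite (subsetP (joing_subr _ _)) ?cycle_id.
case/negP: nzA; rewrite -(maxA B) ?nsBG ?joing_subl //.
by rewrite (subsetP (joing_subr _ _)) ?cycle_id.
Qed.

(* That is, E / H is abelian and self-centralizing in G / H. *)
Lemma nil_self_centralizing_above (gT : finGroupType) (G H : {group gT}) :
  nilpotent G -> H <| G ->
  exists E : {group gT}, [/\ E <| G, H \subset E, E^`(1) \subset H
    & {in G, forall x, {in E, forall e, [~ x, e] \in H} -> x \in E}].
Proof.
move=> nilG nsHG.
have [A maxA _] : {A | [max A | (A <| G / H) && abelian A] & 1%G \subset A}.
  by apply: maxgroup_exists; rewrite normal1 abelian1.
have sCA := nil_max_abelian_cent (quotient_nil H nilG) maxA.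
have /maxgroupP[/andP[nsAG cAA] _] := maxA.
have [E defA sHE nsEG] := inv_quotientN nsHG nsAG.
have nHE : E \subset 'N(H) := subset_trans (normal_sub nsEG) (normal_norm nsHG).
exists E; split=> // [|x Gx cEx].
  by apply: der1_min => //; rewrite -defA.
have Nx : x \in 'N(H) by rewrite (subsetP (normal_norm nsHG)).
suff : coset H x \in E / H.
  case/morphimP => y Ny Ey /(rcoset_kercosetP Nx Ny)/rcosetP[h Hh ->].
  by rewrite groupM // (subsetP sHE).
rewrite -defA (subsetP sCA) // inE mem_quotient //=; apply/centP => w.
rewrite defA => /morphimP[e Ne Ee ->]; apply/commgP; rewrite -morphR //.
by apply/eqP/coset_id/cEx.
Qed.
End SelfCentralizing.

Import Order.TTheory GRing.Theory Num.Theory.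
Local Open Scope group_scope.
Local Open Scope ring_scope.

(** * Convolutions and central characters *)

Section Convolution.
Variable gT : finGroupType.
Implicit Types (A : {set gT}) (x y : gT).

(** The convolution of the indicator of [A] with itself; [conv2] is the fourfold convolution. *)
Definition conv A x : nat := (\sum_(a in A) ((a^-1 * x)%g \in A))%N.

Definition conv2 A x : nat := (\sum_y conv A y * conv A (y^-1 * x)%g)%N.

Lemma sum_conv (R : nzRingType) A (F : gT -> R) :
  \sum_x (conv A x)%:R * F x = \sum_(a in A) \sum_(b in A) F (a * b)%g.
Proof.
transitivity (\sum_x \sum_(a in A) (a^-1 * x \in A)%g%:R * F x).
  by apply: eq_bigr => x _; rewrite natr_sum mulr_suml.
rewrite exchange_big; apply: eq_bigr => a _ /=.
rewrite (reindex_inj (mulgI a)) [RHS]big_mkcond; apply: eq_bigr => b _ /=.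
by rewrite mulKg; case: (b \in A); rewrite (mul0r, mul1r).
Qed.

Lemma sum_conv2 (R : nzRingType) A (F : gT -> R) :
  \sum_x (conv2 A x)%:R * F x =
  \sum_(a in A) \sum_(b in A) \sum_(c in A) \sum_(d in A) F (a * b * (c * d))%g.
Proof.
transitivity (\sum_y (conv A y)%:R * \sum_x (conv A x)%:R * F (y * x)%g).
  transitivity (\sum_x \sum_y (conv A y)%:R * (conv A (y^-1 * x)%g)%:R * F x).
    by apply: eq_bigr => x _; rewrite natr_sum mulr_suml; apply: eq_bigr => y _;
      rewrite natrM.
  rewrite exchange_big; apply: eq_bigr => y _ /=.
  rewrite mulr_sumr (reindex_inj (mulgI y)); apply: eq_bigr => x _ /=.
  by rewrite mulKg mulrA.
by rewrite sum_conv; do 2![apply: eq_bigr => ? _]; rewrite sum_conv.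
Qed.

Lemma sum_conv_card A : (\sum_x conv A x = #|A| ^ 2)%N.
Proof.
have := sum_conv A (fun _ => 1%Z); rewrite -mulr_suml mulr1 -natr_sum.
by rewrite !sumr_const -mulrnA !natz => -[] ->.
Qed.

Lemma conv_gt0 A x : (0 < conv A x)%N -> x \in (A * A)%g.
Proof.
rewrite lt0n sum_nat_eq0 negb_forall => /existsP[a].
rewrite negb_imply eqb0 negbK => /andP[Aa Ax].
by rewrite -(mulKVg a x) mem_mulg.
Qed.

Lemma conv2_gt0 A x : (0 < conv2 A x)%N -> x \in (A * A * (A * A))%g.
Proof.
rewrite lt0n sum_nat_eq0 negb_forall => /existsP[y] /=.
rewrite -lt0n muln_gt0 => /andP[/conv_gt0 Ay /conv_gt0 Ax].
by rewrite -(mulKVg y x) mem_mulg.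
Qed.

Lemma convJ A x y : (A :^ y = A)%g -> conv A (x ^ y)%g = conv A x.
Proof.
move=> nAy; rewrite /conv (reindex_inj (conjg_inj y)) /=.
apply: eq_big => [a | a _]; first by rewrite -{1}nAy memJ_conjg.
by rewrite -conjVg -conjMg -{1}nAy memJ_conjg.
Qed.

Lemma convV A x : A^-1%g = A -> (forall y, A :^ y = A)%g -> conv A x^-1%g = conv A x.
Proof.
move=> AV nA; rewrite /conv (reindex_inj invg_inj) /=.
apply: eq_big => [a | a _]; first by rewrite -mem_invg AV.
have -> : ((a^-1)^-1 * x^-1 \in A)%g = (x * a^-1 \in A)%g.
  by rewrite -{1}AV mem_invg invMg !invgK.
by rewrite -(memJ_conjg _ a) nA conjgE mulgKV.
Qed.
End Convolution.

Section CentralCharacter.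
Variables (gT : finGroupType) (G : {group gT}).
Implicit Types (A : {set gT}) (i : Iirr G).

(** The Fourier coefficient of the indicator of [A]: for normal [A], the scalar by which the sum
    over [A] acts in the representation. *)
Definition omega A i : algC := (\sum_(a in A) 'chi_i a) / 'chi_i 1%g.

(* Schur's lemma: the sum over a normal set acts as a scalar. *)
Lemma sum_irr_mulr A i g : A \subset G -> (forall y, A :^ y = A)%g -> g \in G ->
  \sum_(a in A) 'chi_i (a * g)%g = omega A i * 'chi_i g.
Proof.
move=> sAG nA Gg; pose Z := \sum_(a in A) 'Chi_i a.
have Zscal : is_scalar_mx Z.
  apply: (mx_abs_irr_cent_scalar (groupC (socle_irr (socle_of_Iirr i)))).
  apply/centgmxP => x Gx; rewrite mulmx_suml mulmx_sumr.
  rewrite [RHS](reindex_inj (conjg_inj x)) /=.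
  have nAE a : (a ^ x \in A)%g = (a \in A) by rewrite -{1}(nA x) memJ_conjg.
  rewrite [RHS](eq_bigl _ _ nAE); apply: eq_bigr => a Aa.
  have Ga := subsetP sAG a Aa.
  by rewrite -!repr_mxM ?groupJ // -conjgC.
have trZ g' : g' \in G -> \sum_(a in A) 'chi_i (a * g')%g = \tr (Z *m 'Chi_i g').
  move=> Gg'; rewrite mulmx_suml raddf_sum /=; apply: eq_bigr => a /(subsetP sAG) Ga.
  by rewrite -irrRepr cfunE groupM // -repr_mxM.
case/is_scalar_mxP: Zscal => z Zz.
have trz g' : g' \in G -> \sum_(a in A) 'chi_i (a * g')%g = z * 'chi_i g'.
  by move=> Gg'; rewrite trZ // Zz mul_scalar_mx linearZ /= -irrRepr cfunE Gg'.
rewrite trz //; congr (_ * _); apply: (canRL (mulfK (irr1_neq0 i))).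
rewrite -trz //; by apply: eq_bigr => a _; rewrite mulg1.
Qed.

Lemma omega_real A i : A^-1%g = A -> omega A i \is Num.real.
Proof.
move=> AV; rewrite CrealE; apply/eqP; rewrite /omega rmorphM fmorphV /=.
congr (_ * _); last by rewrite conj_natr // Cnat_irr1.
rewrite rmorph_sum (reindex_inj invg_inj) /=.
apply: eq_big => [a | a _]; first by rewrite -mem_invg AV.
by rewrite irr_inv conjCK.
Qed.

(** Fourier inversion; since the coefficients are real, the conjugation in the inner product
    disappears. *)
Lemma irr_expansion (phi : gT -> nat) (c : Iirr G -> algC) :
    (forall x, x \notin G -> phi x = 0%N) ->
    (forall x y, y \in G -> phi (x ^ y)%g = phi x) ->
    (forall i, c i \is Num.real) ->
    (forall i, \sum_x (phi x)%:R * 'chi_i x = c i) ->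
  forall x, (phi x)%:R = \sum_i c i / #|G|%:R * 'chi_i x.
Proof.
move=> phi0 phiJ cR sumc.
have Pcf : is_class_fun <<G>>%g [ffun x => (phi x)%:R : algC].
  rewrite genGid; apply: intro_class_fun => [x y _ Gy | x nGx].
    by rewrite phiJ.
  by rewrite phi0.
pose Phi : 'CF(G) := Cfun 0 Pcf.
have PhiE x : Phi x = (phi x)%:R by rewrite cfunE.
move=> x; rewrite -PhiE {1}[Phi]cfun_sum_cfdot sum_cfunE.
apply: eq_bigr => i _; rewrite cfunE; congr (_ * _).
rewrite cfdotE mulrC; congr (_ / _).
rewrite -[c i]conj_Creal // -sumc rmorph_sum [RHS](bigID [in G]) /=.
rewrite [X in _ = _ + X]big1 ?addr0 => [|y nGy]; last by rewrite cfun0 // mulr0 conjC0.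
by apply: eq_bigr => y _; rewrite PhiE rmorphM /= rmorph_nat.
Qed.

Section NormalSet.
Variable A : {set gT}.
Hypotheses (sAG : A \subset G) (nA : forall y, (A :^ y = A)%g) (AV : A^-1%g = A).
Implicit Types (x y g : gT).

Lemma sum_conv_irr i g : g \in G ->
  \sum_x (conv A x)%:R * 'chi_i (x * g)%g = omega A i ^+ 2 * 'chi_i g.
Proof.
move=> Gg; rewrite (sum_conv _ (fun x => 'chi_i (x * g)%g)) exchange_big /=.
rewrite expr2 -mulrA -sum_irr_mulr // mulr_sumr; apply: eq_bigr => b Ab.
rewrite -sum_irr_mulr ?groupM // ?(subsetP sAG) //.
by apply: eq_bigr => a _; rewrite mulgA.
Qed.

Lemma sum_conv2_irr i :
  \sum_x (conv2 A x)%:R * 'chi_i x = omega A i ^+ 4 * 'chi_i 1%g.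
Proof.
rewrite sum_conv2 (exprD _ 2 2) -mulrA -sum_conv_irr //.
under [in RHS]eq_bigr do rewrite mulg1.
rewrite sum_conv mulr_sumr.
have E c d : c \in A -> d \in A ->
    \sum_(a in A) \sum_(b in A) 'chi_i (a * b * (c * d))%g
    = omega A i ^+ 2 * 'chi_i (c * d)%g.
  move=> Ac Ad; rewrite -sum_conv_irr ?groupM ?(subsetP sAG) //.
  by rewrite (sum_conv _ (fun x => 'chi_i (x * (c * d))%g)).
under eq_bigr do rewrite exchange_big /=.
rewrite exchange_big; apply: eq_bigr => c Ac /=; rewrite mulr_sumr.
under eq_bigr do rewrite exchange_big /=.
by rewrite exchange_big; apply: eq_bigr => d Ad /=; rewrite E.
Qed.

Lemma conv_irrE x :
  (conv A x)%:R = \sum_i omega A i ^+ 2 * 'chi_i 1%g / #|G|%:R * 'chi[G]_i x.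
Proof.
apply: irr_expansion => [{}x nGx | {}x y _ | i | i].
- apply: contraNeq nGx; rewrite -lt0n => /conv_gt0; apply: subsetP.
  by rewrite mul_subG.
- by rewrite convJ.
- by rewrite rpredM ?rpredX ?omega_real // ger0_real ?ltW ?irr1_gt0.
by rewrite -sum_conv_irr //; apply: eq_bigr => y _; rewrite mulg1.
Qed.

Lemma conv2J x y : conv2 A (x ^ y)%g = conv2 A x.
Proof.
rewrite /conv2 (reindex_inj (conjg_inj y)) /=; apply: eq_bigr => z _.
by rewrite -conjVg -conjMg !convJ.
Qed.

Lemma conv2_irrE x :
  (conv2 A x)%:R = \sum_i omega A i ^+ 4 * 'chi_i 1%g / #|G|%:R * 'chi[G]_i x.
Proof.
apply: irr_expansion => [{}x nGx | {}x y _ | i | i].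
- apply: contraNeq nGx; rewrite -lt0n => /conv2_gt0; apply: subsetP.
  by rewrite !mul_subG.
- by rewrite conv2J.
- by rewrite rpredM ?rpredX ?omega_real // ger0_real ?ltW ?irr1_gt0.
exact: sum_conv2_irr.
Qed.

End NormalSet.
End CentralCharacter.

(** Cauchy-Schwarz against the constant 1, doubled so that 2 f(x) f(y) <= f(x)^2 + f(y)^2 applies
    termwise in [nat]. *)
Lemma sum_sqr_le (I : finType) (B : {set I}) (f : I -> nat) :
  ((\sum_(x in B) f x) ^ 2 <= #|B| * \sum_(x in B) f x ^ 2)%N.
Proof.
rewrite -(leq_pmul2l (isT : 0 < 2)%N) -mulnn big_distrl /=.
have -> : (#|B| * \sum_(x in B) f x ^ 2 =
           \sum_(x in B) \sum_(y in B) f y ^ 2)%N by rewrite sum_nat_const.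
rewrite [X in (_ <= X)%N]mulSn mul1n {1}exchange_big -big_split big_distrr /=.
apply: leq_sum => x _; rewrite -big_split !big_distrr /=.
by apply: leq_sum => y _; rewrite nat_Cauchy.
Qed.

(** The distance |m - n|: at least one of the truncated differences is 0. *)
Definition adiff (m n : nat) : nat := (m - n + (n - m))%N.

Lemma adiffE (R : numDomainType) m n : (adiff m n)%:R = `|m%:R - n%:R| :> R.
Proof.
rewrite /adiff; case: (leqP m n) => [le_mn | /ltnW le_nm].
  by rewrite distrC -natrB // normr_nat; congr _%:R; lia.
by rewrite -natrB // normr_nat; congr _%:R; lia.
Qed.

Lemma adiff_triangle b a c : (adiff a c <= adiff a b + adiff b c)%N.
Proof. rewrite /adiff; lia. Qed.

Lemma adiff0n n : adiff 0 n = n. Proof. by rewrite /adiff subn0. Qed.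

Lemma adiffn0 n : adiff n 0 = n. Proof. by rewrite /adiff subn0 addn0. Qed.

Section Deviation.
Variables (gT : finGroupType) (A : {set gT}).
Hypotheses (nA : forall y, (A :^ y = A)%g).
Implicit Types (x y g : gT).

(** The L1 distance between [conv A] and its translate by [x]. For normal [A] it is the length
    function of a bi-invariant pseudo-metric. *)
Definition dev x : nat := (\sum_y adiff (conv A (x * y)%g) (conv A y))%N.

Lemma convC x y : conv A (x * y)%g = conv A (y * x)%g.
Proof. by rewrite -(convJ (y * x)%g (nA y)) conjgE mulgA mulKg. Qed.

Lemma dev1 : dev 1%g = 0%N.
Proof. by rewrite /dev big1 // => y _; rewrite mul1g /adiff subnn. Qed.

Lemma devV x : dev x^-1%g = dev x.
Proof.
rewrite /dev (reindex_inj (mulgI x)) /=; apply: eq_bigr => y _.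
by rewrite mulKg /adiff addnC.
Qed.

Lemma devM x y : (dev (x * y)%g <= dev x + dev y)%N.
Proof.
rewrite /dev [X in (_ <= X + _)%N](reindex_inj (mulgI y)) -big_split /=.
by apply: leq_sum => z _; rewrite mulgA; exact: adiff_triangle.
Qed.

Lemma devJ x y : dev (x ^ y)%g = dev x.
Proof.
rewrite /dev (reindex_inj (conjg_inj y)) /=; apply: eq_bigr => z _.
by rewrite -conjMg !convJ.
Qed.

(** For [x] outside A^4 the supports of [conv A] and of its translate are disjoint, and the distance
    takes its full value 2 |A|^2. *)
Lemma dev_lt x : (dev x < 2 * #|A| ^ 2)%N -> A^-1%g = A ->
  x \in (A * A * (A * A))%g.
Proof.
move=> ltd AV; apply: contraLR ltd => nx; rewrite -leqNgt mul2n -addnn -sum_conv_card.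
rewrite /dev {1}(reindex_inj (mulgI x)) -big_split /=; apply: leq_sum => y _.
case: (posnP (conv A (x * y)%g)) => [-> | /conv_gt0 Axy].
  by rewrite adiff0n.
case: (posnP (conv A y)) => [-> | /conv_gt0 Ay]; first by rewrite adiffn0 addn0.
case/negP: nx; rewrite -(mulgK y x) mem_mulg //.
by rewrite -mem_invg invMg AV.
Qed.

(** By symmetry [conv2 A 1] is the sum of the squares of [conv A]; Cauchy-Schwarz on the support
    [A * A] bounds it below. *)
Lemma conv2_1_ge K : A^-1%g = A -> (#|A * A| <= K * #|A|)%g%N ->
  (#|A| ^ 3 <= K * conv2 A 1%g)%N.
Proof.
move=> AV A2; case: (posnP #|A|) => [-> // | A_gt0].
have c2E : conv2 A 1%g = (\sum_(y in (A * A)%g) conv A y ^ 2)%N.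
  rewrite /conv2 (bigID [in (A * A)%g]) /= [X in (_ + X)%N]big1 ?addn0.
    by apply: eq_bigr => y _; rewrite mulg1 convV.
  move=> y nAy; case: (posnP (conv A y)) => [-> // | /conv_gt0].
  by rewrite (negPf nAy).
have := sum_sqr_le (A * A)%g (conv A).
have -> : (\sum_(x in (A * A)%g) conv A x = #|A| ^ 2)%N.
  rewrite -sum_conv_card [RHS](bigID [in (A * A)%g]) /= [X in (_ + X)%N]big1 ?addn0 //.
  move=> y nAy; case: (posnP (conv A y)) => [-> // | /conv_gt0].
  by rewrite (negPf nAy).
rewrite -c2E => le4; rewrite -(leq_pmul2r A_gt0).
apply: leq_trans (_ : #|(A * A)%g| * conv2 A 1 <= _)%N.
  by apply: leq_trans le4; rewrite -expnM -expnSr.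
by rewrite mulnAC leq_mul2r A2 orbT.
Qed.
End Deviation.

(** * The large spectrum and Bogolyubov's argument *)

Section Spectrum.
Variables (gT : finGroupType) (G : {group gT}) (A : {set gT}) (K : nat).
Hypotheses (sAG : A \subset G) (nA : forall y, (A :^ y = A)%g) (AV : A^-1%g = A).

(** The threshold is chosen so that at most 1/8 of [conv2 A 1] comes from outside. *)
Definition spec : {set Iirr G} :=
  [set i | #|A|%:R ^+ 2 <= (8 * K)%:R * omega A i ^+ 2].

(** The character is an eigenfunction of convolution with [conv A], of eigenvalue [omega A i ^+ 2].
    The left side is therefore a pairing of the character with the difference of [conv A] and a
    translate. *)
Lemma dev_irr i x : x \in G ->
  omega A i ^+ 2 * `|'chi[G]_i 1%g - 'chi_i x| <= 'chi_i 1%g * (dev A x)%:R.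
Proof.
move=> Gx; have w2 : 0 <= omega A i ^+ 2 by rewrite real_exprn_even_ge0 ?omega_real.
rewrite -{1}(ger0_norm w2) -normrM mulrBr -!sum_conv_irr //.
under eq_bigr do rewrite mulg1.
rewrite [X in _ - X](reindex_inj (mulIg x^-1)%g) /=.
under [X in _ - X]eq_bigr do rewrite mulgKV.
rewrite -sumrB; apply: le_trans (ler_norm_sum _ _ _) _.
rewrite -devV /dev natr_sum mulr_sumr; apply: ler_sum => y _.
rewrite -mulrBl normrM adiffE distrC mulrC -(convC nA).
by apply: ler_wpM2r => //; apply: char1_ge_norm (irr_char i).
Qed.

Lemma spec_dev i x : i \in spec -> x \in G ->
  #|A|%:R ^+ 2 * `|'chi[G]_i 1%g - 'chi_i x| <= 'chi_i 1%g * (8 * K * dev A x)%:R.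
Proof.
rewrite inE => si Gx; apply: le_trans (ler_wpM2r (normr_ge0 _) si) _.
rewrite -mulrA (natrM _ (8 * K)) [leRHS]mulrCA; apply: ler_wpM2l; first exact: ler0n.
exact: dev_irr.
Qed.

(** The share of ['chi_i] in the expansion of [conv2 A 1]. *)
Definition spec_weight i : algC :=
  omega A i ^+ 4 * 'chi[G]_i 1%g ^+ 2 / #|G|%:R / (conv2 A 1%g)%:R.

Hypotheses (A1 : 1%g \in A) (A2 : (#|A * A| <= K * #|A|)%g%N).

Let K_gt0 : (0 < K)%N.
Proof.
case: K A2 => //; rewrite mul0n leqn0 cards_eq0 => /eqP A0.
by have := mem_mulg A1 A1; rewrite A0 inE.
Qed.

Let A_gt0 : (0 < #|A|)%N. Proof. by rewrite card_gt0; apply/set0Pn; exists 1%g. Qed.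

Let c2_gt0 : (0 < conv2 A 1%g)%N.
Proof.
have := conv2_1_ge nA AV A2; rewrite lt0n; apply: contraTneq => ->.
by rewrite muln0 -ltnNge expn_gt0 A_gt0.
Qed.

Lemma spec_weight_ge0 i : 0 <= spec_weight i.
Proof.
rewrite !divr_ge0 ?ler0n // mulr_ge0 // ?real_exprn_even_ge0 ?omega_real //.
by rewrite ger0_real // ltW ?irr1_gt0.
Qed.

Lemma sum_spec_weight : \sum_i spec_weight i = 1.
Proof.
rewrite -mulr_suml; apply: (canLR (mulfK _)); first by rewrite pnatr_eq0 -lt0n.
rewrite mul1r (conv2_irrE sAG) //; apply: eq_bigr => i _.
by ring.
Qed.

(** Off the spectrum two of the four factors [omega A i] contribute at most |A|^2 / (8K). The
    remaining sum is at most [conv A 1], which equals |A|, and |A|^3 is at most K times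
    [conv2 A 1]. *)
Lemma sum_spec_weightC : \sum_(i | i \notin spec) spec_weight i <= 1 / 8.
Proof.
have c20 : 0 < (conv2 A 1%g)%:R :> algC by rewrite ltr0n.
rewrite -mulr_suml ler_pdivrMr // -(ler_pM2l (_ : 0 < (8 * K)%:R)) ?ltr0n ?muln_gt0 //.
apply: le_trans (_ : #|A|%:R ^+ 3 <= _); last first.
  rewrite natrM mul1r -mulrA mulrCA mulVKf ?pnatr_eq0 // -natrM -natrX ler_nat.
  exact: conv2_1_ge.
have := conv_irrE sAG nA AV 1%g.
have -> : conv A 1%g = #|A|.
  rewrite -sum1_card; apply: eq_bigr => a Aa.
  by rewrite mulg1 -mem_invg AV Aa.
move=> Ae; rewrite exprSr {2}Ae mulr_sumr mulr_sumr [X in _ <= X](bigID [in spec]) /=.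
rewrite -[X in X <= _]add0r lerD //.
  apply: sumr_ge0 => i _; rewrite mulr_ge0 ?exprn_ge0 ?ler0n // mulr_ge0 ?(ltW (irr1_gt0 _)) //.
  rewrite divr_ge0 ?ler0n // mulr_ge0 ?(ltW (irr1_gt0 _)) //.
  by rewrite real_exprn_even_ge0 ?omega_real.
apply: ler_sum => i; rewrite inE => nsi.
have w2R : (8 * K)%:R * omega A i ^+ 2 \is Num.real.
  by rewrite rpredM ?rpredX ?omega_real ?realn.
rewrite -real_ltNge // in nsi; last by rewrite rpredX ?realn.
have -> : (8 * K)%:R * (omega A i ^+ 4 * 'chi_i 1%g ^+ 2 / #|G|%:R) =
  ((8 * K)%:R * omega A i ^+ 2) * (omega A i ^+ 2 * 'chi_i 1%g / #|G|%:R * 'chi_i 1%g).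
  by ring.
apply: ler_wpM2r; last exact: ltW.
rewrite mulr_ge0 ?(ltW (irr1_gt0 _)) // divr_ge0 ?ler0n //.
by rewrite mulr_ge0 ?(ltW (irr1_gt0 _)) // real_exprn_even_ge0 ?omega_real.
Qed.

(* The characters outside the spectrum carry little of the mass of 1_A^{*4}. *)
Lemma spec_Bogolyubov x : x \in G ->
    `|\sum_(i in spec) spec_weight i * (1 - 'chi[G]_i x / 'chi_i 1%g)| <= 1 / 2 ->
  x \in (A * A * (A * A))%g.
Proof.
move=> Gx small; apply: contraLR isT => nx.
have c2x : conv2 A x = 0%N by apply/eqP; rewrite -leqn0 leqNgt; apply: contra nx; exact: conv2_gt0.
have E : 1 = \sum_i spec_weight i * (1 - 'chi[G]_i x / 'chi_i 1%g).
  under eq_bigr do rewrite mulrBr mulr1.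
  rewrite sumrB sum_spec_weight.
  suff -> : \sum_i spec_weight i * ('chi[G]_i x / 'chi_i 1%g) =
            (conv2 A x)%:R / (conv2 A 1%g)%:R by rewrite c2x mul0r subr0.
  rewrite (conv2_irrE sAG) // mulr_suml; apply: eq_bigr => i _.
  rewrite /spec_weight expr2 -[in RHS](divfK (irr1_neq0 i) ('chi_i x)).
  by ring.
(* Off the spectrum each term is at most twice its weight, so the total 1 would be at most 3/4. *)
have n1 : `|1 : algC| <= 1 / 2 + 1 / 8 * 2.
  rewrite {1}E (bigID [in spec]) /=; apply: le_trans (ler_normD _ _) _.
  apply: lerD => //; apply: le_trans (ler_norm_sum _ _ _) _.
  apply: le_trans (_ : \sum_(i | i \notin spec) spec_weight i * 2 <= _).
    apply: ler_sum => i _; rewrite normrM (ger0_norm (spec_weight_ge0 i)).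
    apply: ler_wpM2l; first exact: spec_weight_ge0.
    apply: le_trans (ler_normB _ _) _; rewrite normr1 lerD2l normrM normfV.
    rewrite (ger0_norm (ltW (irr1_gt0 i))) ler_pdivrMr ?irr1_gt0 // mul1r.
    by rewrite char1_ge_norm ?irr_char.
  by rewrite -mulr_suml ler_wpM2r ?ler0n // sum_spec_weightC.
have half : 1 / 2 + 1 / 8 * 2 = 1 - 1 / 4 :> algC by field.
by move: n1; rewrite normr1 half lerBrDr gerDl lt_geF // divr_gt0 ?ltr01 ?ltr0n.
Qed.
End Spectrum.

(** * Almost periods *)

(** The variance of a sum of k independent samples of mean 0: the cross terms vanish. *)
Lemma sum_ffun_sqr (R : comNzRingType) (T : finType) (A : {set T}) (k : nat) (g : T -> R) :
    \sum_(a in A) g a = 0 ->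
  \sum_(t : {ffun 'I_k -> T} | t \in ffun_on A) (\sum_i g (t i)) ^+ 2
  = (k * #|A| ^ k.-1)%:R * \sum_(a in A) g a ^+ 2.
Proof.
move=> g0.
transitivity (\sum_(i < k) \sum_(j < k)
  \sum_(t : {ffun 'I_k -> T} | t \in ffun_on A) g (t i) * g (t j)).
  under eq_bigr do (rewrite expr2 mulr_suml; under eq_bigr do rewrite mulr_sumr).
  by rewrite exchange_big; apply: eq_bigr => i _; rewrite exchange_big.
(* The product of two samples, written as a product over all coordinates [l], so that the sum over
   [t] factors. *)
pose h (i j l : 'I_k) a := (if l == i then g a else 1) * (if l == j then g a else 1).
have hE i j : \sum_(t : {ffun 'I_k -> T} | t \in ffun_on A) g (t i) * g (t j)
            = \prod_l \sum_(a in A) h i j l a.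
  rewrite bigA_distr_big; apply: eq_bigr => t _.
  rewrite big_split /= (bigD1 i) //= eqxx big1 ?mulr1 => [|l /negPf-> //].
  by congr (_ * _); rewrite (bigD1 j) //= eqxx big1 ?mulr1 => [|l /negPf->].
rewrite natrM -mulrA -[X in X%:R * _](card_ord k) mulr_natl -sumr_const.
apply: eq_bigr => i _; rewrite (bigD1 i) //= [X in _ + X]big1 => [|j ne_ji].
  rewrite addr0 hE (bigD1 i) //= mulrC; congr (_ * _).
    rewrite (eq_bigr (fun => #|A|%:R)); last first.
      by move=> l /negPf nli; rewrite -sumr_const; apply: eq_bigr => a _; rewrite /h nli mulr1.
    rewrite prodr_const natrX; congr (_ ^+ _).
    by have := cardC1 i; rewrite card_ord => <-; apply: eq_card => l; rewrite !inE.
  by apply: eq_bigr => a _; rewrite /h eqxx expr2.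
rewrite hE (bigD1 i) //= [X in X * _](_ : _ = 0) ?mul0r // -[RHS]g0.
by apply: eq_bigr => a _; rewrite /h eqxx eq_sym (negPf ne_ji) mulr1.
Qed.

Lemma adiffC m n : adiff m n = adiff n m.
Proof. by rewrite /adiff addnC. Qed.

Section CrootSisask.
Variables (gT : finGroupType) (A : {set gT}) (K : nat).
Hypotheses (K_gt0 : (0 < K)%N) (A_gt0 : (0 < #|A|)%N) (A2 : (#|A * A| <= K * #|A|)%g%N).
Implicit Types (x y z : gT).

(** The [x] that move [conv A] by at most 1/n of its L1 norm |A|^2. *)
Definition almost_periods n : {set gT} := [set x | (n * dev A x <= #|A| ^ 2)%N].

Section Sample.
Variable k : nat.
Implicit Types t u : {ffun 'I_k -> gT}.

(** A random sample of k translates of [A]: |A| / k times it estimates [conv A x], and [err] is k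
    times the L1 error of this estimate. *)
Definition sample t x : nat := (\sum_(i < k) ((t i)^-1 * x \in A)%g)%N.

Definition err t : nat := (\sum_x adiff (k * conv A x) (#|A| * sample t x))%N.

(** At each [x] this is the variance formula for [g], whose squares sum to at most |A|^2 times
    [conv A x]; then sum over [x]. *)
Lemma sum_err_sqr :
  (\sum_(t in ffun_on A) \sum_x adiff (k * conv A x) (#|A| * sample t x) ^ 2
    <= k * #|A| ^ (k + 3))%N.
Proof.
rewrite exchange_big /=.
have xle x : (\sum_(t in ffun_on A) adiff (k * conv A x) (#|A| * sample t x) ^ 2 <=
              k * #|A| ^ k.-1 * (#|A| ^ 2 * conv A x))%N.
  pose g a : int := (conv A x)%:R - #|A|%:R * (a^-1 * x \in A)%g%:R.
  have g0 : \sum_(a in A) g a = 0.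
    rewrite sumrB sumr_const -mulr_sumr -natr_sum -[_ *+ #|A|]mulr_natl -/(conv A x).
    by rewrite subrr.
  rewrite -(ler_nat int) natr_sum natrM.
  rewrite (eq_bigr (fun t : {ffun 'I_k -> gT} => (\sum_i g (t i)) ^+ 2)); last first.
    move=> t _; rewrite natrX adiffE real_normK ?num_real //; congr (_ ^+ 2).
    by rewrite sumrB sumr_const card_ord -mulr_sumr -natr_sum !natrM mulr_natl.
  rewrite sum_ffun_sqr //; apply: ler_wpM2l; first exact: ler0n.
  have -> : \sum_(a in A) g a ^+ 2 = #|A|%:R * ((conv A x)%:R * (#|A|%:R - (conv A x)%:R)).
    transitivity (\sum_(a in A) ((conv A x)%:R ^+ 2 +
        (#|A|%:R ^+ 2 - 2 * #|A|%:R * (conv A x)%:R) * (a^-1 * x \in A)%g%:R) : int).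
      by apply: eq_bigr => a _; rewrite /g; case: (_ \in A) => /=; ring.
    rewrite big_split /= sumr_const -mulr_sumr -natr_sum -/(conv A x) -[_ *+ #|A|]mulr_natl.
    by ring.
  rewrite natrM natrX expr2 -mulrA; apply: ler_wpM2l; first exact: ler0n.
  by rewrite mulrC; apply: ler_wpM2r; rewrite ?ler0n // gerBl ler0n.
apply: (@leq_trans (\sum_x k * #|A| ^ k.-1 * (#|A| ^ 2 * conv A x))%N).
  by apply: leq_sum => x _; exact: xle.
rewrite -!big_distrr /= sum_conv_card -mulnA leq_mul2l -!expnD.
by case: k => [|k'] //=; rewrite (addSnnS k' 3).
Qed.

(** Cauchy-Schwarz passes from L2 to L1, since all errors live on [A * A], of size at most K |A|. *)
Lemma sum_err : (\sum_(t in ffun_on A) err t ^ 2 <= k * K * #|A| ^ (k + 4))%N.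
Proof.
apply: leq_trans (_ : K * #|A| * (k * #|A| ^ (k + 3)) <= _)%N; last first.
  by rewrite [(k + 4)%N]addnS expnS; lia.
apply: leq_trans (leq_mul (leqnn _) sum_err_sqr); rewrite big_distrr /=.
apply: leq_sum => t tA.
have errE : err t = (\sum_(x in (A * A)%g) adiff (k * conv A x) (#|A| * sample t x))%N.
  rewrite /err (bigID [in (A * A)%g]) /= [X in (_ + X)%N]big1 ?addn0 // => x nAx.
  case: (posnP (conv A x)) => [-> | /conv_gt0]; last by rewrite (negPf nAx).
  rewrite /sample big1 ?muln0 // => i _; apply/eqP; rewrite eqb0.
  apply: contra nAx => Aix; rewrite -(mulKVg (t i) x) mem_mulg //.
  by have /ffun_onP := tA; apply.
rewrite errE; apply: leq_trans (sum_sqr_le _ _) _.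
apply: leq_mul => //.
by rewrite [X in (_ <= X)%N](bigID [in (A * A)%g]) /= leq_addr.
Qed.

(** Samples whose squared error is at most twice the bound on its mean; by Markov's inequality they
    are at least half of all. *)
Definition good : {set {ffun 'I_k -> gT}} :=
  [set t in ffun_on A | (err t ^ 2 <= 2 * k * K * #|A| ^ 4)%N].

Lemma card_good : (0 < k)%N -> (#|A| ^ k <= 2 * #|good|)%N.
Proof.
move=> k_gt0; pose F : {set {ffun 'I_k -> gT}} := [set t in ffun_on A].
pose bad := F :\: good.
have cardA : (#|good| + #|bad| = #|A| ^ k)%N.
  have := card_ffun_on 'I_k (mem A); rewrite card_ord => <-.
  rewrite -(cardsE (ffun_on A)) -[RHS](cardsID good); congr (_ + _)%N.
  by apply: eq_card => t; rewrite !inE andbA andbb.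
have pos : (0 < 2 * k * K * #|A| ^ 4)%N by rewrite !muln_gt0 k_gt0 K_gt0 A_gt0.
have : (#|bad| * (2 * k * K * #|A| ^ 4) <= k * K * #|A| ^ (k + 4))%N.
  rewrite -sum_nat_const; apply: leq_trans sum_err.
  rewrite [X in (_ <= X)%N](bigID [in good]) /= addnC; apply: leq_trans (leq_addr _ _).
  rewrite [X in (_ <= X)%N](eq_bigl [in bad]) => [|t]; last by rewrite !inE andbC.
  apply: leq_sum => t; rewrite !inE => /andP[ngood tA].
  by move: ngood; rewrite tA /= -ltnNge => /ltnW.
rewrite expnD -cardA; nia.
Qed.

Definition shift z u : {ffun 'I_k -> gT} := [ffun i => z * u i]%g.

Lemma shiftK z : cancel (shift z) (shift z^-1).
Proof. by move=> u; apply/ffunP => i; rewrite !ffunE mulKg. Qed.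

Lemma err_shift z u : err (shift z u) =
  (\sum_x adiff (k * conv A (z * x)%g) (#|A| * sample u x))%N.
Proof.
rewrite /err (reindex_inj (mulgI z)) /=; apply: eq_bigr => x _.
congr (adiff _ (_ * _)); apply: eq_bigr => i _.
by rewrite ffunE invMg -mulgA mulKg.
Qed.

(** Both errors compare a translate of [conv A] with the same function [sample u]. *)
Lemma dev_shift z z' u :
  (k * dev A (z * z'^-1)%g <= err (shift z u) + err (shift z' u))%N.
Proof.
rewrite !err_shift /dev -big_split big_distrr /= (reindex_inj (mulgI z')) /=.
apply: leq_sum => x _; rewrite mulgA mulgKV.
rewrite [X in (_ <= _ + X)%N]adiffC.
apply: leq_trans (adiff_triangle _ _ _).
by rewrite /adiff mulnDr !mulnBr.
Qed.

(** Count pairs of [z] in [A] and [u] with entries in [A * A] such that the shift of [u] by [z^-1]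
    is good. Each [z] brings in every good sample, while for fixed [u] two admissible [z] differ by
    an almost period. *)
Lemma card_good_almost_periods n : (0 < k)%N -> (8 * K * n ^ 2 <= k)%N ->
  (#|A| * #|good| <= #|(A * A)%g| ^ k * #|almost_periods n|)%N.
Proof.
move=> k_gt0 le_k.
have := card_ffun_on 'I_k (mem (A * A)%g); rewrite card_ord => <-.
apply: (@leq_trans (\sum_(z in A) \sum_(u in ffun_on (A * A)%g) (shift z^-1 u \in good)))%N.
  rewrite -sum_nat_const; apply: leq_sum => z Az.
  rewrite -sum1_card (reindex_onto (shift z^-1) (shift z)) /=; last first.
    by move=> t _; rewrite shiftK.
  rewrite big_mkcond [X in (_ <= X)%N]big_mkcond; apply: leq_sum => u _.
  have -> : shift z (shift z^-1 u) = u by rewrite -{1}[z]invgK shiftK.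
  rewrite eqxx andbT; case: ifP => // gu.
  case: ifP => // /negP[]; apply/ffun_onP => i.
  move: gu; rewrite inE => /andP[/ffun_onP/(_ i)].
  by rewrite ffunE => Ai _; rewrite -(mulKVg z (u i)) mem_mulg.
rewrite exchange_big /= -sum_nat_const; apply: leq_sum => u _.
rewrite -big_mkcondr sum1dep_card.
set Z := [set z | _]; have [-> | [z0 Zz0]] := set_0Vmem Z; first by rewrite cards0.
have inj : injective (fun z => z^-1 * z0)%g by move=> z z' /mulIg/invg_inj.
rewrite -(card_imset _ inj); apply/subset_leq_card/subsetP => _ /imsetP[z Zz ->].
have errZ y : y \in Z -> (err (shift y^-1 u) ^ 2 <= 2 * k * K * #|A| ^ 4)%N.
  by rewrite !inE => /andP[_ /andP[]].
have := dev_shift z^-1 z0^-1 u; rewrite invgK inE.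
move: (errZ z Zz) (errZ z0 Zz0) le_k.
move: (err _) (err _) (dev A _) => e' e d e2 e'2 le_k le_d.
rewrite -(leq_exp2r _ _ (isT : 0 < 2)%N) -expnM [(2 * 2)%N]/=.
(* From k d <= e + e' and (e + e')^2 <= 2 (e^2 + e'^2) <= 8 k K |A|^4. *)
have d2 : (k * d ^ 2 <= 8 * K * #|A| ^ 4)%N.
  rewrite -(leq_pmul2l k_gt0); apply: (@leq_trans ((e + e') ^ 2)%N).
    have -> : (k * (k * d ^ 2) = (k * d) ^ 2)%N by rewrite expnMn -mulnn mulnA.
    by rewrite leq_exp2r.
  have : (2 * (e * e') <= e ^ 2 + e' ^ 2)%N by exact: nat_Cauchy.
  rewrite sqrnD; move: e2 e'2.
  move: (#|A| ^ 4)%N (e ^ 2)%N (e' ^ 2)%N (e * e')%N => a b b' c; lia.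
rewrite expnMn -(leq_pmul2l (_ : 0 < 8 * K)%N) ?muln_gt0 //.
by apply: leq_trans d2; rewrite mulnA leq_mul2r le_k orbT.
Qed.
End Sample.

Theorem Croot_Sisask n : (0 < n)%N ->
  (#|A| <= 2 * K ^ (8 * K * n ^ 2) * #|almost_periods n|)%N.
Proof.
move=> n_gt0; set k := (8 * K * n ^ 2)%N.
have k_gt0 : (0 < k)%N by rewrite !muln_gt0 K_gt0 n_gt0.
rewrite -(leq_pmul2r (_ : 0 < #|A| ^ k)%N) ?expn_gt0 ?A_gt0 //.
apply: leq_trans (leq_mul (leqnn _) (card_good k_gt0)) _.
rewrite mulnCA; apply: leq_trans (leq_mul (leqnn _) (card_good_almost_periods k_gt0 (leqnn _))) _.
have le_k : (#|(A * A)%g| ^ k <= K ^ k * #|A| ^ k)%N by rewrite -expnMn leq_exp2r.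
apply: leq_trans (leq_mul (leqnn 2) (leq_mul le_k (leqnn _))) _.
by rewrite -!mulnA [(#|A| ^ k * _)%N]mulnC.
Qed.
End CrootSisask.

(** * Almost periods lie in an abelian section *)

Section Mass.
Variable gT : finGroupType.
Implicit Types (G E P N : {group gT}) (f : gT -> algC).

(* If f is a nonnegative combination of characters of G and N is normal in G, then mass N f is
   the part of f 1 carried by the constituents that are nontrivial on N. *)
Definition mass (N : {set gT}) f : algC := f 1%g - (\sum_(x in N) f x) / #|N|%:R.

(** If the trivial character occurs in the restriction to a normal subgroup, that subgroup lies in
    the kernel; otherwise the average vanishes. *)
Lemma sum_irr_normal G N (j : Iirr G) : N <| G ->
  (\sum_(x in N) 'chi_j x) / #|N|%:R = 'chi_j 1%g *+ (N \subset cfker 'chi_j).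
Proof.
move=> nsNG; have sNG := normal_sub nsNG; case: (boolP (N \subset _)) => [kN | nkN].
  rewrite (eq_bigr (fun => 'chi_j 1%g)) => [|x Nx]; last by rewrite cfker1 ?(subsetP kN).
  by rewrite sumr_const -[_ *+ #|N|]mulr_natr mulfK ?neq0CG.
have : '['Res[N] 'chi_j, 'chi_0] = 0.
  by apply: contraNeq nkN => c0; apply: constt0_Res_cfker; rewrite ?irr_consttE.
rewrite cfdotE mulrC irr0 => E0; rewrite mulr0n -[RHS]E0.
congr (_ / _); apply: eq_bigr => x Nx.
by rewrite cfResE // cfun1E Nx conjC1 mulr1.
Qed.

Definition poscf G (phi : 'CF(G)) := forall j, 0 <= '[phi, 'chi_j].

Lemma poscf_char G (phi : 'CF(G)) chi : poscf phi -> chi \is a character -> 0 <= '[phi, chi].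
Proof.
move=> phi0 chiC; rewrite cfdot_sum_irr; apply: sumr_ge0 => i _.
rewrite mulr_ge0 //; have := Cnat_cfdot_char_irr i chiC.
by case/natrP => n ->; rewrite conjC_nat ler0n.
Qed.

Lemma poscf_Res G E (phi : 'CF(G)) : poscf phi -> poscf ('Res[E] phi).
Proof. by move=> phi0 j; rewrite cfdot_Res_l poscf_char ?cfInd_char ?irr_char. Qed.

Lemma irr_cfdotE G (phi : 'CF(G)) x : phi x = \sum_j '[phi, 'chi_j] * 'chi_j x.
Proof. by rewrite {1}[phi]cfun_sum_cfdot sum_cfunE; apply: eq_bigr => j _; rewrite cfunE. Qed.

Lemma massE G N (phi : 'CF(G)) : N <| G ->
  mass N phi = \sum_(j | ~~ (N \subset cfker 'chi_j)) '[phi, 'chi_j] * 'chi_j 1%g.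
Proof.
move=> nsNG; rewrite /mass.
under eq_bigr do rewrite irr_cfdotE.
rewrite exchange_big (irr_cfdotE phi 1%g) /= mulr_suml -sumrB [RHS]big_mkcond.
apply: eq_bigr => j _; rewrite -mulr_sumr -mulrA sum_irr_normal //.
by case: (N \subset _); rewrite ?mulr1n ?subrr // mulr0n mulr0 subr0.
Qed.

Lemma massD (N : {set gT}) f g : mass N (fun x => f x + g x) = mass N f + mass N g.
Proof. by rewrite /mass big_split mulrDl opprD addrACA. Qed.

Lemma eq_mass (N : {set gT}) f g : {in N, f =1 g} -> f 1%g = g 1%g -> mass N f = mass N g.
Proof. by move=> fg fg1; rewrite /mass fg1 (eq_bigr g). Qed.

Lemma mass_Res E N (G : {group gT}) (phi : 'CF(G)) : E \subset G -> N \subset E ->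
  mass N ('Res[E] phi) = mass N phi.
Proof.
move=> sEG sNE; apply: eq_mass => [x Nx|]; rewrite cfResE ?group1 //.
exact: (subsetP sNE).
Qed.

Section Positive.
Variables (G : {group gT}) (phi : 'CF(G)).
Hypothesis (phi0 : poscf phi).

Let term_ge0 j : 0 <= '[phi, 'chi_j] * 'chi_j 1%g.
Proof. by rewrite mulr_ge0 ?(ltW (irr1_gt0 _)). Qed.

(** Every summand of [massE] is nonnegative. *)
Lemma mass_ge0 N : N <| G -> 0 <= mass N phi.
Proof. by move=> nsNG; rewrite massE // sumr_ge0. Qed.

(** A character nontrivial on [N] is nontrivial on [N1] or on [N2]. *)
Lemma mass_join N1 N2 N : N1 <| G -> N2 <| G -> N <| G -> N \subset N1 <*> N2 ->
  mass N phi <= mass N1 phi + mass N2 phi.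
Proof.
move=> ns1 ns2 ns sN; rewrite !massE // [leLHS]big_mkcond.
rewrite [X in _ <= X + _]big_mkcond [X in _ <= _ + X]big_mkcond -big_split /=; apply: ler_sum => j _.
case: (boolP (N \subset _)) => [_ | nk].
  by apply: addr_ge0; case: ifP.
case: (boolP (N1 \subset _)) => k1 /=; last by rewrite lerDl; case: ifP.
case: (boolP (N2 \subset _)) => k2 /=; last by rewrite add0r.
case/negP: nk; apply: subset_trans sN _.
by rewrite join_subG k1 k2.
Qed.

(** Constituents trivial on [N] take the same value at [x] as at 1; each other one changes by at
    most twice its degree. *)
Lemma mass_pointwise N x : N <| G -> x \in N -> `|phi 1%g - phi x| <= 2 * mass N phi.
Proof.
move=> nsNG Nx; rewrite massE //.
rewrite !(irr_cfdotE phi) -sumrB mulr_sumr; apply: le_trans (ler_norm_sum _ _ _) _.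
rewrite [X in _ <= X]big_mkcond; apply: ler_sum => j _ /=; rewrite -mulrBr.
case: (boolP (N \subset _)) => [kN | _] /=.
  by rewrite cfker1 ?(subsetP kN) // subrr mulr0 normr0.
rewrite mulrCA normrM (ger0_norm (phi0 j)); apply: ler_wpM2l => //.
apply: le_trans (ler_normB _ _) _; rewrite mulr2n mulrDl mul1r.
by apply: lerD; apply: char1_ge_norm (irr_char j).
Qed.

(* The constituents of phi other than 1 all have small multiplicity, so phi concentrates
   around its mean on G. *)
Lemma mass_second_moment tau : 0 <= tau ->
    (forall j : Iirr G, j != 0 -> exists N : {group gT},
      [/\ N <| G, ~~ (N \subset cfker 'chi_j) & mass N phi <= tau]) ->
  \sum_(x in G) `|phi x - phi 1%g + mass G phi| ^+ 2 <= #|G|%:R * (tau * phi 1%g).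
Proof.
move=> tau0 cover; pose c := '[phi, 'chi_0].
have avgE : phi 1%g - mass G phi = c.
  rewrite /mass opprB addrC subrK /c irr0 cfdotE [RHS]mulrC; congr (_ / _).
  by apply: eq_bigr => x Gx; rewrite cfun1E Gx conjC1 mulr1.
pose psi := phi - c *: 1.
have psiE : {in G, forall x, phi x - phi 1%g + mass G phi = psi x}.
  move=> x Gx; rewrite -addrA -[- _ + _]opprK opprD opprK avgE.
  by rewrite !cfunE cfun1E Gx mulr1.
have coef j : '[psi, 'chi_j] = '[phi, 'chi_j] *+ (j != 0).
  rewrite cfdotBl cfdotZl -(irr0 G) cfdot_irr eq_sym.
  by case: eqVneq => [-> | _]; rewrite ?mulr1 ?subrr // mulr0 subr0.
have : '[psi] <= tau * phi 1%g.
  rewrite cfdot_sum_irr [phi in X in _ <= X]cfun_sum_cfdot sum_cfunE mulr_sumr.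
  apply: ler_sum => j _; rewrite coef cfunE; case: (boolP (j == 0)) => [_ | j0].
    by rewrite mul0r mulr_ge0.
  rewrite mulr1n; have [N [nsNG nk le_tau]] := cover j j0.
  have le_c : '[phi, 'chi_j] * 'chi_j 1%g <= tau.
    apply: le_trans le_tau; rewrite massE // (bigD1 j) //= lerDl sumr_ge0 //.
  rewrite (geC0_conj (phi0 j)) [leRHS]mulrCA; apply: ler_wpM2l => //.
  have chi1_ge1 : 1 <= 'chi_j 1%g.
    have := irr1_gt0 j; have /natrP[n ->] := Cnat_irr1 j.
    by rewrite ltr0n ler1n.
  apply: le_trans (_ : '[phi, 'chi_j] * 'chi_j 1%g <= _).
    by rewrite -{1}['[_, _]]mulr1 ler_wpM2l.
  apply: le_trans le_c _; by rewrite -{1}[tau]mulr1 ler_wpM2l.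
rewrite (cfnormE (cfun_onG _)) mulrC ler_pdivrMr ?gt0CG // mulrC; congr (_ <= _).
by apply: eq_bigr => x Gx; rewrite psiE.
Qed.
End Positive.
End Mass.

Section SpectralSum.
Variables (gT : finGroupType) (G : {group gT}) (A : {set gT}) (K : nat).
Hypotheses (sAG : A \subset G) (nA : forall y, (A :^ y = A)%g) (AV : A^-1%g = A) (A1 : 1%g \in A).
Implicit Types (w : Iirr G -> algC).

Local Notation spec := (spec G A K).

(** Characters are divided by their degrees so that the value at 1 is the total weight. *)
Definition spec_sum w : 'CF(G) := \sum_(i in spec) (w i / 'chi_i 1%g) *: 'chi_i.

Lemma spec_sumE w x : spec_sum w x = \sum_(i in spec) w i * ('chi_i x / 'chi_i 1%g).
Proof. by rewrite sum_cfunE; apply: eq_bigr => i _; rewrite cfunE; ring. Qed.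

Lemma spec_sum1 w : spec_sum w 1%g = \sum_(i in spec) w i.
Proof. by rewrite spec_sumE; apply: eq_bigr => i _; rewrite divff ?irr1_neq0 ?mulr1. Qed.

Lemma spec_sumB w x :
  spec_sum w 1%g - spec_sum w x = \sum_(i in spec) w i * (1 - 'chi_i x / 'chi_i 1%g).
Proof. by rewrite spec_sum1 spec_sumE -sumrB; apply: eq_bigr => i _; ring. Qed.

Lemma cfdot_spec_sum w j : '[spec_sum w, 'chi_j] = (w j / 'chi_j 1%g) *+ (j \in spec).
Proof.
rewrite cfdot_suml big_mkcond (bigD1 j) //= big1 => [|i ne_ij]; last first.
  by case: ifP => // _; rewrite cfdotZl cfdot_irr (negPf ne_ij) mulr0.
by case: (j \in _) => /=; rewrite addr0 // cfdotZl cfnorm_irr mulr1.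
Qed.

Lemma spec_sum_pos w : (forall i, 0 <= w i) -> poscf (spec_sum w).
Proof.
move=> w0 j; rewrite cfdot_spec_sum; case: (_ \in _); rewrite ?mulr0n ?mulr1n //.
by rewrite divr_ge0 // ltW ?irr1_gt0.
Qed.

Lemma spec_sum_kerM w x h : (forall i, i \in spec -> h \in cfker 'chi_i) ->
  spec_sum w (x * h)%g = spec_sum w x.
Proof.
by move=> hk; rewrite !spec_sumE; apply: eq_bigr => i si; rewrite cfkerMr ?hk.
Qed.

Lemma spec_dev_close m i x : i \in spec -> x \in G ->
  (8 * K * m * dev A x <= #|A| ^ 2)%N -> m%:R * `|1 - 'chi_i x / 'chi_i 1%g| <= 1.
Proof.
move=> si Gx le_m; have c0 := irr1_gt0 i.
have -> : 1 - 'chi_i x / 'chi_i 1%g = ('chi_i 1%g - 'chi_i x) / 'chi_i 1%g.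
  by rewrite mulrBl divff ?irr1_neq0.
rewrite normrM normfV (ger0_norm (ltW c0)) mulrA ler_pdivrMr // mul1r.
have A_gt0 : 0 < #|A|%:R ^+ 2 :> algC.
  by rewrite exprn_gt0 // ltr0n card_gt0; apply/set0Pn; exists 1%g.
rewrite -(ler_pM2l A_gt0) mulrCA.
apply: le_trans (ler_wpM2l (ler0n _ m) (spec_dev sAG nA AV si Gx)) _.
rewrite mulrCA [leRHS]mulrC; apply: ler_wpM2l; first exact: ltW.
rewrite -natrM -natrX ler_nat; apply: leq_trans le_m.
by rewrite -!mulnA mulnCA [(m * _)%N]mulnCA.
Qed.

Lemma spec_sum_close w m x : (forall i, 0 <= w i) -> x \in G ->
    (8 * K * m * dev A x <= #|A| ^ 2)%N ->
  m%:R * `|spec_sum w 1%g - spec_sum w x| <= spec_sum w 1%g.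
Proof.
move=> w0 Gx le_m; rewrite spec_sumB spec_sum1.
apply: le_trans (ler_wpM2l (ler0n _ m) (ler_norm_sum _ _ _)) _.
rewrite mulr_sumr; apply: ler_sum => i si; rewrite normrM (ger0_norm (w0 i)) mulrCA.
by rewrite -[leRHS]mulr1 ler_wpM2l // spec_dev_close.
Qed.

Definition spec_ker : {group gT} := [group of \bigcap_(i in spec) cfker 'chi_i].

Lemma spec_kerP h : h \in spec_ker -> forall i, i \in spec -> h \in cfker 'chi_i.
Proof. by move=> hk i si; move: hk => /bigcapP; apply. Qed.
End SpectralSum.

(** * Commutators of almost periods with the self-centralizing subgroup *)

Section AlmostPeriodsAreAbelian.
Variables (gT : finGroupType) (A : {set gT}) (K C : nat).
Hypotheses (nA : forall y, (A :^ y = A)%g) (AV : A^-1%g = A) (A1 : 1%g \in A).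
Hypotheses (K_gt0 : (0 < K)%N) (A2 : (#|A * A| <= K * #|A|)%g%N).
Hypothesis A8 : (#|(A * A * (A * A)) * (A * A * (A * A))| <=
  C * #|almost_periods A (16 * K * 64)|)%g%N.
Local Notation G := [set: gT]%G.
Local Notation spec := (spec G A K).
Local Notation H := (spec_ker G A K).
Let sAG : A \subset G. Proof. exact: subsetT. Qed.

Lemma spec_ker_normal : H <| G.
Proof.
rewrite /normal subsetT /=; apply: norms_bigcap; apply/bigcapsP => i _.
exact: cfker_norm.
Qed.

(** On the kernel every term of Bogolyubov's sum vanishes. *)
Lemma spec_ker_sub : H \subset (A * A * (A * A))%g.
Proof.
apply/subsetP => h Hh; apply: (spec_Bogolyubov sAG nA AV A1 A2); rewrite ?inE //.
rewrite big1 ?normr0 ?divr_ge0 ?ler01 ?ler0n // => i si.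
by rewrite cfker1 ?(spec_kerP Hh) // divff ?irr1_neq0 // subrr mulr0.
Qed.

Variable E : {group gT}.
Hypotheses (nsEG : E <| G) (sHE : H \subset E) (dE : (E^`(1))%g \subset H).

Section Commutators.
Variable x : gT.
Hypothesis dev_x : (16 * K * (1024 * C).+1 * dev A x <= #|A| ^ 2)%N.

Definition comm_set : {set gT} := [set [~ x, e.1] * e.2 | e in setX E H]%g.

Let Hnorm e h : h \in H -> (h ^ e)%g \in H.
Proof. by move=> Hh; rewrite memJ_norm // (subsetP (normal_norm spec_ker_normal)) ?inE. Qed.

Let memE e : e \in E -> [~ x, e]%g \in E.
Proof.
move=> Ee; rewrite commgEr groupM // memJ_norm ?groupV //.
by rewrite (subsetP (normal_norm nsEG)) ?inE.
Qed.

Let derH c e : c \in E -> e \in E -> [~ c, e]%g \in H.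
Proof. by move=> Ec Ee; rewrite (subsetP dE) // mem_commg. Qed.

(** Modulo [H], [x, e'e] = [x, e] [x, e']^e equals [x, e] [x, e'], because [x, e'] lies in [E] and E
    / H is abelian. *)
Lemma comm_set_group : group_set comm_set.
Proof.
apply/group_setP; split.
  by apply/imsetP; exists (1, 1)%g; rewrite ?inE ?group1 //= commg1 mulg1.
move=> _ _ /imsetP[[e h] /setXP[/= Ee Hh] ->] /imsetP[[e' h'] /setXP[/= Ee' Hh'] ->] /=.
apply/imsetP; pose c := [~ x, e']%g.
exists (e' * e, ([~ c, e]^-1 * h ^ c * h'))%g; last first.
  have -> : ([~ c, e]^-1 = (c ^ e)^-1 * c)%g by rewrite commgEl invMg invgK.
  rewrite /= commgMJ -/c; move: (c ^ e)%g => d; move: [~ x, e]%g => a; move: c => c.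
  by rewrite (conjgE h) !mulgA !mulgK.
apply/setXP; split=> /=; first exact: groupM.
by apply: groupM Hh'; apply: groupM; [rewrite groupV derH ?memE | exact: Hnorm].
Qed.

Definition comm_group : {group gT} := Group comm_set_group.

Lemma sub_comm_group : H \subset comm_group.
Proof.
apply/subsetP => h Hh; apply/imsetP; exists (1, h)%g; rewrite ?inE ?group1 //=.
by rewrite commg1 mul1g.
Qed.

Lemma comm_group_sub : comm_group \subset E.
Proof.
apply/subsetP => _ /imsetP[[e h] /setXP[/= Ee Hh] ->].
by apply: groupM; [apply: memE | apply: (subsetP sHE)].
Qed.

Section Character.
Variable i0 : Iirr G.
Hypotheses (si0 : i0 \in spec) (nk : ~~ (comm_group \subset cfker 'chi_i0)).

(** [Theta1] decides membership in A^4 by Bogolyubov's argument and [Theta0] is the normalised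
    character [i0]. Their sum lets one mass control both. *)
Let w1 := @spec_weight _ G A.
Let w0 (i : Iirr G) : algC := (i == i0)%:R.
Let Theta1 := @spec_sum _ G A K w1.
Let Theta0 := @spec_sum _ G A K w0.
Let Theta := @spec_sum _ G A K (fun i => w1 i + w0 i).

Let w1_ge0 i : 0 <= w1 i. Proof. exact: spec_weight_ge0. Qed.
Let w0_ge0 i : 0 <= w0 i. Proof. exact: ler0n. Qed.
Let w_ge0 i : 0 <= w1 i + w0 i. Proof. exact: addr_ge0. Qed.

Let ThetaD y : Theta y = Theta1 y + Theta0 y.
Proof.
by rewrite /Theta /Theta1 /Theta0 !spec_sumE -big_split; apply: eq_bigr => i _; rewrite mulrDl.
Qed.

Let Theta_le2 : Theta 1%g <= 2.
Proof.
rewrite /Theta spec_sum1 big_split /= mulr2n; apply: lerD.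
  rewrite -(sum_spec_weight sAG nA AV A1 A2) [leRHS](bigID [in spec]) /= lerDl.
  by apply: sumr_ge0.
by rewrite (bigD1 i0) //= /w0 eqxx big1 ?addr0 // => i /andP[_ /negPf->].
Qed.

Let n := (1024 * C).+1.
Let tau : algC := 2 / n%:R.

Let tau_ge0 : 0 <= tau. Proof. by rewrite divr_ge0 ?ler0n. Qed.

(** A commutator is a product of [x^-1] and a conjugate of [x], so its deviation is at most twice
    that of [x]; hence 16 K in [dev_x] against 8 K in [spec_sum_close]. *)
Let Theta_comm l : l \in comm_group -> `|Theta 1%g - Theta l| <= tau.
Proof.
case/imsetP => -[e h] /setXP[/= Ee Hh] ->; rewrite /Theta spec_sum_kerM; last first.
  exact: spec_kerP.
rewrite ler_pdivlMr ?ltr0n // mulrC; apply: le_trans Theta_le2.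
apply: spec_sum_close => //.
apply: leq_trans dev_x.
have : (dev A [~ x, e]%g <= 2 * dev A x)%N.
  apply: leq_trans (devM _ _ _) _; rewrite devV // devJ // addnn mul2n leqnn //.
move=> le2; apply: leq_trans (leq_mul (leqnn _) le2) _.
by rewrite [leqLHS]mulnCA -!mulnA (mulnA 2 8).
Qed.

(** This is why masses are computed after restriction to [E]: the conjugates of [comm_group] need
    not be normal in [G]. *)
Let Enormal (N : {group gT}) : H \subset N -> N \subset E -> N <| E.
Proof. by move=> sHN; apply: sub_der1_normal; apply: subset_trans sHN. Qed.

Let massRes (N : {group gT}) (w : Iirr G -> algC) : N \subset E ->
  mass N ('Res[E] (spec_sum A K w)) = mass N (spec_sum A K w).
Proof. by move=> sNE; apply: mass_Res => //; apply: subsetT. Qed.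

Let mass_small (N : {group gT}) : H \subset N -> N \subset E ->
  {in N, forall l, `|Theta 1%g - Theta l| <= tau} -> mass N Theta <= tau.
Proof.
move=> sHN sNE Nl; apply: le_trans (_ : `|mass N Theta| <= _).
  rewrite real_ler_norm // ger0_real // -massRes // mass_ge0 ?Enormal //.
  exact/poscf_Res/spec_sum_pos.
have -> : mass N Theta = (\sum_(l in N) (Theta 1%g - Theta l)) / #|N|%:R.
  by rewrite sumrB sumr_const -[_ *+ #|N|]mulr_natr mulrBl mulfK ?neq0CG.
rewrite normrM normfV normr_nat ler_pdivrMr ?gt0CG //.
apply: le_trans (ler_norm_sum _ _ _) _.
by rewrite mulr_natr -sumr_const; apply: ler_sum.
Qed.

Let Py (Y : {set gT}) : {group gT} := (H <*> \bigcup_(y in Y) comm_group :^ y)%G.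

Let PyE (Y : {set gT}) : Py Y = (<<H :|: \bigcup_(y in Y) comm_group :^ y>>)%g :> {set gT}.
Proof. by []. Qed.

Let sHPy Y : H \subset Py Y. Proof. exact: joing_subl. Qed.

Let sLE y : (comm_group :^ y)%g \subset E.
Proof.
have /normsP/(_ y (in_setT y)) <- := normal_norm nsEG.
by rewrite conjSg comm_group_sub.
Qed.

Let sHL y : H \subset (comm_group :^ y)%g.
Proof.
have /normsP/(_ y (in_setT y)) <- := normal_norm spec_ker_normal.
by rewrite conjSg sub_comm_group.
Qed.

Let sPyE Y : Py Y \subset E.
Proof. by rewrite join_subG sHE; apply/bigcupsP => y _; apply: sLE. Qed.

Let mass_conj y : mass (comm_group :^ y)%G Theta <= tau.
Proof.
apply: (@mass_small (comm_group :^ y)%G (sHL y) (sLE y)) => w /imsetP[l Ll ->].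
by rewrite cfunJ ?inE // Theta_comm.
Qed.

Let mass_H : mass H Theta <= tau.
Proof.
apply: (mass_small (subxx _) sHE) => h Hh.
by rewrite -(mul1g h) /Theta spec_sum_kerM ?subrr ?normr0 //; apply: spec_kerP.
Qed.

(** With all conjugates the group is normal in [G] and [i0] is nontrivial on it, so the full weight
    1 of [Theta0] counts. *)
Let mass_Pfull : 1 <= mass (Py setT) Theta.
Proof.
have nsP : Py setT <| G.
  rewrite /normal subsetT normsY ?(normal_norm spec_ker_normal) //.
  apply/subsetP => g _; rewrite inE; apply/subsetP => _ /imsetP[l /bigcupP[y _ ly] ->].
  apply/bigcupP; exists (y * g)%g; first by rewrite inE.
  by rewrite /= conjsgM memJ_conjg.
rewrite massE // (bigD1 i0) /=; last first.
  apply: contra nk; apply: subset_trans; apply: subset_trans (joing_subr _ _).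
  by apply: subset_trans (bigcup_sup 1%g _); rewrite ?inE // conjsg1.
rewrite cfdot_spec_sum si0 mulr1n divfK ?irr1_neq0 // (_ : w0 i0 = 1); last by rewrite /w0 eqxx.
rewrite [w1 i0 + _]addrC -addrA lerDl.
rewrite addr_ge0 //; apply: sumr_ge0 => j _.
rewrite mulr_ge0 ?(ltW (irr1_gt0 _)) //; exact: spec_sum_pos.
Qed.

(* Adding one conjugate raises the mass by at most tau, so a minimal Y overshoots 1 / 8 only slightly. *)
Let exists_P : exists Y, 1 / 8 <= mass (Py Y) Theta <= 1 / 8 + tau.
Proof.
pose big Y := 1 / 8 <= mass (Py Y) Theta.
have bigT : big setT by apply: le_trans mass_Pfull; rewrite ler_pdivrMr ?ltr0n // mul1r ler1n.
have [Y /minsetP[bigY minY] _] := minset_exists bigT.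
exists Y; apply/andP; split; first exact: bigY.
have mR (N : {group gT}) : H \subset N -> N \subset E -> mass N Theta \is Num.real.
  move=> sHN sNE; rewrite ger0_real // -massRes // mass_ge0 ?Enormal //.
  exact/poscf_Res/spec_sum_pos.
have [Y0 | [y Yy]] := set_0Vmem Y.
  have -> : mass (Py Y) Theta = mass H Theta.
    by congr mass; rewrite Y0 PyE big_set0 setU0 genGid.
  by apply: le_trans mass_H _; rewrite lerDr divr_ge0 ?ler01 ?ler0n.
have nbig : ~~ big (Y :\ y).
  apply/negP => bigY'; have E' := minY _ bigY' (subsetDl _ _).
  by move: Yy; rewrite -E' !inE eqxx.
have r8 : 1 / 8 \is @Num.real algC by rewrite ger0_real // divr_ge0 ?ler01 ?ler0n.
have rY := mR _ (sHPy (Y :\ y)) (sPyE (Y :\ y)).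
rewrite /big -(real_ltNge rY r8) in nbig.
apply: le_trans (_ : mass (Py (Y :\ y)) Theta + mass (comm_group :^ y)%G Theta <= _).
  rewrite -!massRes ?sPyE ?sLE //; apply: mass_join; rewrite ?Enormal ?sPyE ?sLE ?sHPy ?sHL //.
    exact/poscf_Res/spec_sum_pos.
  rewrite join_subG (subset_trans _ (joing_subl _ _)) ?sHPy //=.
  apply/bigcupsP => z Yz; case: (eqVneq z y) => [-> | nzy]; first exact: joing_subr.
  apply: subset_trans (joing_subl _ _); apply: subset_trans (joing_subr _ _).
  by apply: bigcup_sup; rewrite !inE nzy.
by apply: lerD; [exact: ltW | exact: mass_conj].
Qed.

Let C_gt0 : (0 < C)%N.
Proof.
move: A8; case: (C) => // A80; exfalso; move: A80; rewrite mul0n leqn0 cards_eq0.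
move/eqP => E0; have A2_1 : 1%g \in (A * A)%g by rewrite -(mulg1 1%g) mem_mulg.
have A4_1 : 1%g \in (A * A * (A * A))%g by rewrite -(mulg1 1%g) mem_mulg.
by have := mem_mulg A4_1 A4_1; rewrite E0 inE.
Qed.

Let tau_le : tau <= 1 / 8.
Proof.
rewrite ler_pdivrMr ?ltr0n // -(ler_pM2l (_ : 0 < 8)) ?ltr0n // mulrA.
rewrite mul1r divff ?pnatr_eq0 // mul1r -natrM ler_nat.
by rewrite ltnW // ltnS (@leq_trans (1024 * 1)%N) // leq_mul2l.
Qed.

Lemma comm_group_not_in_ker : False.
Proof.
have [Y /andP[massY_ge massY_le]] := exists_P; pose P := Py Y.
have nsPE : P <| E by rewrite Enormal ?sHPy ?sPyE.
(* The mass of [Theta1] is at most 1/8 + tau <= 1/4, which gives exactly the bound 1/2 that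
   Bogolyubov's argument accepts. *)
have sP4 : P \subset (A * A * (A * A))%g.
  apply/subsetP => p Pp; apply: (spec_Bogolyubov sAG nA AV A1 A2); rewrite ?inE //.
  rewrite -(spec_sumB A K w1) -/Theta1.
  have Ep : p \in E := subsetP (sPyE Y) p Pp.
  have pos1 : poscf ('Res[E] Theta1) by apply/poscf_Res/spec_sum_pos.
  have pos0 : poscf ('Res[E] Theta0) by apply/poscf_Res/spec_sum_pos.
  have := mass_pointwise pos1 nsPE Pp; rewrite !cfResE ?group1 ?subsetT //.
  move/le_trans; apply; rewrite massRes ?sPyE //.
  apply: le_trans (_ : 2 * (1 / 8 + 1 / 8) <= _).
    apply: ler_wpM2l; first exact: ler0n.
    apply: le_trans (_ : mass P Theta <= _); last first.
      by apply: le_trans massY_le _; rewrite lerD2l.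
    have -> : mass P Theta = mass P Theta1 + mass P Theta0.
      by rewrite -massD; apply: eq_mass => // y _; rewrite ThetaD.
    by rewrite lerDl -massRes ?sPyE // mass_ge0.
  by rewrite le_eqVlt; apply/orP; left; apply/eqP; field.
set S := almost_periods A (16 * K * 64).
pose Q := (P :&: S * S^-1)%g.
(* Both [P] and [S] lie in A^4, so [P * S] lies in A^8, and the fibre bound applies. *)
have PQ : (#|P| <= C * #|Q|)%N.
  have S_gt0 : (0 < #|S|)%N.
    rewrite card_gt0; apply/set0Pn; exists 1%g; by rewrite inE dev1 muln0.
  rewrite -(leq_pmul2r S_gt0); apply: leq_trans (card_mulg_fiber P S) _.
  rewrite mulnAC leq_mul2r; apply/orP; right; apply: leq_trans A8.
  apply/subset_leq_card/mulgSS => //; apply/subsetP => s; rewrite inE => devs.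
  apply: dev_lt => //; apply: (@leq_ltn_trans (#|A| ^ 2)%N).
    by apply: leq_trans devs; rewrite leq_pmull // !muln_gt0 K_gt0.
  rewrite -[ltnLHS]mul1n ltn_pmul2r // expn_gt0 card_gt0.
  by apply/orP; left; apply/set0Pn; exists 1%g.
(* The deviation of [p] is at most the sum of two from [S], so [Theta] moves by at most 2/64 = 1/32
   at [p], and 1/8 - 1/32 = 3/32. *)
have Qclose p : p \in Q -> (3 / 32) ^+ 2 <= `|Theta p - Theta 1%g + mass P Theta| ^+ 2.
  case/setIP => Pp /mulsgP[s t Ss]; rewrite inE => St pE.
  have devp : (8 * K * 64 * dev A p <= #|A| ^ 2)%N.
    have : (dev A p <= dev A s + dev A t^-1)%N.
      by rewrite pE [dev _ t^-1]devV devM.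
    move: Ss St; rewrite !inE; move: (#|A| ^ 2)%N => a Ss St le_d.
    rewrite -(leq_pmul2l (isT : 0 < 2)%N) -!mulnA (mulnA 2 8) !mulnA.
    apply: leq_trans (leq_mul (leqnn _) le_d) _.
    by rewrite mulnDr mul2n -addnn leq_add.
  have close : 64 * `|Theta 1%g - Theta p| <= 2.
    apply: le_trans Theta_le2; apply: (@spec_sum_close _ _ _ _ sAG nA AV A1 _ 64) => //.
  rewrite ler_sqr ?nnegrE //; last by rewrite divr_ge0 ?ler0n.
  apply: le_trans (_ : mass P Theta - `|Theta 1%g - Theta p| <= _).
    rewrite lerBrDr; apply: le_trans (massY_ge); rewrite -lerBrDl.
    rewrite -(ler_pM2l (_ : 0 < 64)) ?ltr0n //; apply: le_trans close _.
    by rewrite le_eqVlt; apply/orP; left; apply/eqP; field.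
  rewrite [X in _ <= `|X|]addrC -[Theta p - _]opprB.
  have mR : `|mass P Theta| = mass P Theta.
    rewrite ger0_norm // -massRes ?sPyE // mass_ge0 //; exact/poscf_Res/spec_sum_pos.
  by rewrite -{1}mR lerB_dist.
have sec : \sum_(p in P) `|Theta p - Theta 1%g + mass P Theta| ^+ 2 <= #|P|%:R * (tau * 2).
  have sPG : P \subset G := subsetT _.
  have posP : poscf ('Res[P] Theta) by apply/poscf_Res/spec_sum_pos.
  apply: le_trans (_ : #|P|%:R * (tau * Theta 1%g) <= _); last first.
    by rewrite ler_wpM2l ?ler0n // ler_wpM2l.
  have := @mass_second_moment _ P ('Res[P] Theta) posP tau tau_ge0.
  rewrite cfRes1 (_ : mass P ('Res[P] Theta) = mass P Theta); last exact: mass_Res.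
  move=> moment; apply: le_trans (moment _).
    rewrite le_eqVlt; apply/orP; left; apply/eqP; apply: eq_bigr => p Pp.
    by rewrite cfResE.
  (* A nontrivial character of [P] is nontrivial on [H] or on one of the generating conjugates, each
     normal in [P] and of mass at most tau. *)
  move=> j j0; have [HJ | HJ] := boolP (H \subset cfker 'chi_j); last first.
    exists H; split => //; last by rewrite mass_Res ?mass_H ?sHPy.
    by apply: normalS sPG spec_ker_normal; apply: sHPy.
  have [k | /subsetPn[l /bigcupP[y Yy ly] nl]] :=
      boolP (\bigcup_(y in Y) comm_group :^ y \subset cfker 'chi_j).
    case/negP: j0; by rewrite -subGcfker join_subG HJ.
  have sLP : (comm_group :^ y)%g \subset P.
    by apply: subset_trans (joing_subr _ _); apply: bigcup_sup.
  exists (comm_group :^ y)%G; split.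
  - by apply: normalS (sPyE Y) (Enormal (sHL y) (sLE y)).
  - by apply/subsetPn; exists l.
  by rewrite mass_Res.
have : #|Q|%:R * (3 / 32) ^+ 2 <= #|P|%:R * (tau * 2) :> algC.
  apply: le_trans sec; rewrite mulr_natl -sumr_const [leRHS](bigID [in Q]) /=.
  rewrite -[leLHS]addr0; apply: lerD; last by apply: sumr_ge0 => p _; rewrite exprn_ge0.
  rewrite [leRHS](eq_bigl [in Q]) => [|p]; last by rewrite inE; case: (p \in P).
  exact: ler_sum.
have -> : #|Q|%:R * (3 / 32) ^+ 2 = (#|Q| * 9)%:R / 1024%:R :> algC.
  by rewrite expr_div_n -!natrX natrM mulrA.
have -> : #|P|%:R * (tau * 2) = (#|P| * 4)%:R / n%:R :> algC.
  by rewrite natrM -mulrA /tau [2 / _ * 2]mulrAC -natrM.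
(* With |P| <= C |Q| this would force 9 n <= 4096 C, while n = 1024 C + 1. *)
rewrite ler_pdivrMr ?ltr0n // mulrAC ler_pdivlMr ?ltr0n // -!natrM ler_nat /n => bad.
have Q_gt0 : (0 < #|Q|)%N.
  by move: PQ; case: (#|Q|) => //; rewrite muln0 leqNgt cardG_gt0.
have bad' : (#|Q| * (9 * (1024 * C).+1) <= #|Q| * (C * (4 * 1024)))%N.
  rewrite mulnA; apply: leq_trans bad _.
  by rewrite -mulnA (mulnA #|Q|) [(#|Q| * C)%N]mulnC leq_mul2r PQ orbT.
move: bad'; rewrite leq_pmul2l // leqNgt => /negP[].
rewrite mulnC -mulnA; move: (1024 * C)%N => m.
apply: (@leq_ltn_trans (9 * m)%N); first by rewrite leq_mul2r orbT.
by rewrite mulnS -[ltnLHS]add0n ltn_add2r.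
Qed.

End Character.
End Commutators.

Hypothesis cE : {in G, forall x, {in E, forall e, [~ x, e]%g \in H} -> x \in E}.

Lemma almost_periods_sub : almost_periods A (16 * K * (1024 * C).+1) \subset E.
Proof.
apply/subsetP => x; rewrite inE => dev_x; apply: cE; rewrite ?inE // => e Ee.
apply/bigcapP => i si; apply: contraT => nk.
case: (@comm_group_not_in_ker x dev_x i si); apply/subsetPn.
exists [~ x, e]%g => //; apply/imsetP; exists (e, 1)%g; rewrite ?mulg1 //.
by apply/setXP.
Qed.
End AlmostPeriodsAreAbelian.

(** * Bohr sets *)

Section UnitComplex.
Implicit Types z w : algC.

Lemma norm_mul_sub1 z w : `|z| = 1 -> `|z * w - 1| <= `|z - 1| + `|w - 1|.
Proof.
move=> z1; have -> : z * w - 1 = (z - 1) + z * (w - 1) by ring.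
by apply: le_trans (ler_normD _ _) _; rewrite normrM z1 mul1r.
Qed.

Lemma norm_exp_sub1 z n : `|z| = 1 -> `|z ^+ n - 1| <= n%:R * `|z - 1|.
Proof.
move=> z1; elim: n => [|n IHn]; first by rewrite subrr normr0 mul0r.
rewrite exprS; apply: le_trans (norm_mul_sub1 _ z1) _.
by rewrite -natr1 mulrDl mul1r addrC lerD2r.
Qed.

(** Here |z + 1| >= 2 - 1/2 = 3/2. *)
Lemma norm_sqr_sub1 z : `|z - 1| <= 1 / 2 -> 3 * `|z - 1| <= 2 * `|z ^+ 2 - 1|.
Proof.
move=> z_half; have -> : z ^+ 2 - 1 = (2 + (z - 1)) * (z - 1) by ring.
rewrite normrM mulrA; apply: ler_wpM2r => //.
apply: le_trans (_ : 2 * (`|2| - `|z - 1|) <= _); last first.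
  apply: ler_wpM2l; first exact: ler0n.
  by rewrite -[z - 1]opprK normrN; apply: lerB_dist.
rewrite normr_nat mulrBr lerBrDr; apply: le_trans (_ : 3 + 2 * (1 / 2) <= _).
  by rewrite lerD2l; apply: ler_wpM2l => //; exact: ler0n.
by rewrite le_eqVlt; apply/orP; left; apply/eqP; field.
Qed.

(** Two squarings expand the distance to 1 by 9/4 at least, and (4/9)(1/2) < 1/4. *)
Lemma norm_sqr_sqr_sub1 z : `|z - 1| <= 1 / 2 -> `|z ^+ 2 - 1| <= 1 / 2 ->
  `|(z ^+ 2) ^+ 2 - 1| <= 1 / 2 -> `|z - 1| <= 1 / 4.
Proof.
move=> z1 z2 z4; have le1 := norm_sqr_sub1 z1; have le2 := norm_sqr_sub1 z2.
have : 9 * `|z - 1| <= 9 * (1 / 4).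
  have -> : 9 * `|z - 1| = 3 * (3 * `|z - 1|) by ring.
  apply: le_trans (ler_wpM2l (ler0n _ 3) le1) _.
  rewrite mulrCA; apply: le_trans (ler_wpM2l (ler0n _ 2) le2) _.
  apply: le_trans (ler_wpM2l (ler0n _ 2) (ler_wpM2l (ler0n _ 2) z4)) _.
  have -> : 9 * (1 / 4) = 2 * (2 * (1 / 2)) + 1 / 4 :> algC by field.
  by rewrite lerDl divr_ge0 ?ler01 ?ler0n.
by rewrite ler_pM2l ?ltr0n.
Qed.
End UnitComplex.

Section BohrSets.
Variables (gT : finGroupType) (E H : {group gT}) (T : {set gT}) (K : nat).
Hypotheses (sTE : T \subset E) (nT : forall y, (T :^ y = T)%g) (TV : T^-1%g = T) (T1 : 1%g \in T).
Hypotheses (T2 : (#|T * T| <= K * #|T|)%g%N).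
Hypotheses (nsHE : H <| E) (nH : forall y, (H :^ y)%g = H) (nE : forall y, (E :^ y)%g = E).
Hypotheses (dE : (E^`(1))%g \subset H) (TH : (T * H)%g = T).
Local Notation spec := (spec E T K).

Let T_gt0 : (0 < #|T|)%N. Proof. by rewrite card_gt0; apply/set0Pn; exists 1%g. Qed.

(** [T] is a union of cosets of [H], so a character nontrivial on [H] sums to 0 over [T] and is not
    in the spectrum. The others contain E' in their kernel. *)
Lemma spec_lin i : i \in spec -> 'chi_i \is a linear_char.
Proof.
move=> si; rewrite lin_irr_der1; apply: subset_trans dE _; apply: contraLR si => nk.
have wH0 : omega H i = 0.
  have := sum_irr_normal i nsHE; rewrite (negPf nk) mulr0n => /eqP.
  by rewrite mulf_eq0 invr_eq0 (negPf (neq0CG _)) orbF /omega => /eqP ->; rewrite mul0r.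
have ThE h : h \in H -> (fun t : gT => t * h)%g @: T = T.
  move=> Hh; apply/eqP; rewrite eqEcard card_imset ?leqnn ?andbT; last exact: mulIg.
  by apply/subsetP => _ /imsetP[t Tt ->]; rewrite -TH mem_mulg.
have w0 : (\sum_(t in T) 'chi_i t) * #|H|%:R = 0.
  transitivity (\sum_(h in H) \sum_(t in T) 'chi_i (t * h)%g).
    rewrite mulr_natr -sumr_const; apply: eq_bigr => h Hh.
    rewrite -{1}(ThE h Hh) big_imset //=; exact: in2W (mulIg h).
  rewrite exchange_big /=; apply: big1 => t Tt.
  rewrite (eq_bigr (fun h => 'chi_i (h * t)%g)) => [|h Hh].
    by rewrite sum_irr_mulr ?(normal_sub nsHE) ?(subsetP sTE) // wH0 mul0r.
  by rewrite -[LHS](cfunJ _ _ (subsetP sTE t Tt)) conjgE !mulgA mulVg mul1g.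
move/eqP: w0; rewrite mulf_eq0 (negPf (neq0CG _)) orbF => /eqP w0.
rewrite inE /omega w0 mul0r expr0n mulr0 -natrX.
by rewrite lern0 expn_eq0 andbT -lt0n.
Qed.

(** A substitute for the Bohr set of radius about 2^-j; constraining dyadic powers instead of the
    radius makes squaring shift the index exactly. *)
Definition Bohr j : {set gT} := [set x in E |
  [forall i in spec, forall t : 'I_j.+1, `|'chi_i x ^+ (2 ^ t) - 1| <= 1 / 2]].

Lemma BohrP j x : reflect (x \in E /\
    forall i, i \in spec -> forall t, (t <= j)%N -> `|'chi_i x ^+ (2 ^ t) - 1| <= 1 / 2)
  (x \in Bohr j).
Proof.
rewrite inE; apply: (iffP andP) => -[Ex B]; split=> //.
  by move=> i si t le_tj; have /forall_inP/(_ i si)/forallP/(_ (inord t)) := B; rewrite inordK.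
by apply/forall_inP => i si; apply/forallP => t; apply: B; rewrite // -ltnS.
Qed.

Lemma Bohr_sub j : Bohr j \subset E.
Proof. by apply/subsetP => x /BohrP[]. Qed.

Lemma Bohr_mono j l : (j <= l)%N -> Bohr l \subset Bohr j.
Proof.
move=> le_jl; apply/subsetP => x /BohrP[Ex B]; apply/BohrP; split=> // i si t le_tj.
exact: B (leq_trans le_tj le_jl).
Qed.

Lemma Bohr1 j : 1%g \in Bohr j.
Proof.
apply/BohrP; split=> // i si t _; rewrite (lin_char1 (spec_lin si)) expr1n subrr normr0.
by rewrite divr_ge0 ?ler01 ?ler0n.
Qed.

Lemma BohrV j x : x \in Bohr j -> x^-1%g \in Bohr j.
Proof.
move=> /BohrP[Ex B]; apply/BohrP; rewrite groupV; split=> // i si t le_tj.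
have -> : 'chi_i x^-1%g ^+ (2 ^ t) - 1 = ('chi_i x ^+ (2 ^ t) - 1)^*.
  by rewrite irr_inv rmorphB rmorphXn rmorph1.
by rewrite norm_conjC B.
Qed.

Lemma Bohr_mul j x y : x \in Bohr j.+2 -> y \in Bohr j.+2 -> (x * y)%g \in Bohr j.
Proof.
move=> /BohrP[Ex Bx] /BohrP[Ey By]; apply/BohrP; split=> [|i si t le_tj]; first exact: groupM.
have lini := spec_lin si; rewrite lin_charM // exprMn.
have quarter z : z \in E -> (forall t, (t <= j.+2)%N -> `|'chi_i z ^+ (2 ^ t) - 1| <= 1 / 2) ->
    `|'chi_i z ^+ (2 ^ t) - 1| <= 1 / 4.
  move=> Ez Bz; apply: norm_sqr_sqr_sub1; first by apply: Bz; rewrite !leqW.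
    by rewrite -exprM -expnSr; apply: Bz; rewrite ltnS leqW.
  have -> : (('chi_i z ^+ (2 ^ t)) ^+ 2) ^+ 2 = 'chi_i z ^+ (2 ^ t.+2).
    by rewrite -!exprM !expnSr mulnA.
  by apply: Bz; rewrite !ltnS.
apply: le_trans (norm_mul_sub1 _ _) _; first by rewrite normrX normC_lin_char ?expr1n.
apply: le_trans (lerD (quarter x Ex (Bx i si)) (quarter y Ey (By i si))) _.
by rewrite le_eqVlt; apply/orP; left; apply/eqP; field.
Qed.

Lemma BohrX2 j x : x \in Bohr j.+1 -> (x ^+ 2)%g \in Bohr j.
Proof.
move=> /BohrP[Ex B]; apply/BohrP; split=> [|i si t le_tj]; first exact: groupX.
by rewrite (lin_charX (spec_lin si)) // -exprM -expnS B.
Qed.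

(** Linear characters turn the quotient of squares into the square of the quotient. Only the
    exponent 2^0 is not reached this way, hence the condition at scale 0. *)
Lemma Bohr_quotient_sqr j x y : x \in E -> y \in E -> (x^-1 * y)%g \in Bohr 0 ->
  ((x ^+ 2)^-1 * y ^+ 2)%g \in Bohr j -> (x^-1 * y)%g \in Bohr j.+1.
Proof.
move=> Ex Ey /BohrP[_ B0] /BohrP[_ Bj]; apply/BohrP.
split=> [|i si [|t] le_tj]; rewrite ?groupM ?groupV //; first exact: B0.
have lini := spec_lin si; have := Bj i si t le_tj.
rewrite !lin_charM ?lin_charV ?lin_charX ?groupV ?groupX //.
by move=> le1; rewrite expnS exprM [(_ * _) ^+ 2]exprMn exprVn.
Qed.

(** Conjugation permutes the spectrum, since [T] is normal. *)
Lemma BohrJ j y : (Bohr j :^ y = Bohr j)%g.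
Proof.
have subJ z x : x \in Bohr j -> (x ^ z)%g \in Bohr j.
  have Nz u : u \in 'N(E) by rewrite inE nE.
  move=> /BohrP[Ex B]; apply/BohrP; split=> [|i si t le_tj].
    by rewrite -(nE z) memJ_conjg.
  have -> : 'chi_i (x ^ z)%g = 'chi_(conjg_Iirr i z^-1) x.
    by rewrite conjg_IirrE cfConjgE ?invgK.
  apply: B => //; move: si; rewrite !inE; congr (_ <= _ * _ ^+ 2); rewrite /omega.
  rewrite conjg_IirrE cfConjg1; congr (_ / _).
  rewrite (reindex_inj (conjg_inj z)) /=; apply: eq_big => [t' | t' _].
    by rewrite -{1}(nT z) memJ_conjg.
  by rewrite cfConjgE ?invgK.
apply/setP => x; apply/idP/idP => [/imsetP[x' Bx' ->] | Bx]; first exact: subJ.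
by rewrite -[x](conjgKV y) memJ_conjg subJ.
Qed.

Lemma Bohr0_sub : Bohr 0 \subset (T * T * (T * T))%g.
Proof.
apply/subsetP => x /BohrP[Ex B]; apply: (spec_Bogolyubov sTE nT TV T1 T2) => //.
apply: le_trans (ler_norm_sum _ _ _) _.
apply: le_trans (_ : \sum_(i in spec) spec_weight T i * (1 / 2) <= _).
  apply: ler_sum => i si; rewrite normrM (ger0_norm (spec_weight_ge0 TV i)).
  apply: ler_wpM2l; first exact: spec_weight_ge0.
  by rewrite (lin_char1 (spec_lin si)) divr1 distrC; apply: (B i si 0%N).
rewrite -mulr_suml -[leRHS]mul1r; apply: ler_wpM2r; first by rewrite divr_ge0 ?ler01 ?ler0n.
rewrite -(sum_spec_weight sTE nT TV T1 T2) [leRHS](bigID [in spec]) /= lerDl.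
by apply: sumr_ge0 => i _; apply: spec_weight_ge0.
Qed.

(** The distance of the character value to 1 is at most 2^-(j+1), and raising to the power 2^t
    multiplies it by at most 2^j. *)
Lemma almost_periods_Bohr j : (0 < K)%N ->
  almost_periods T (8 * K * 2 ^ j.+1) \subset Bohr j.
Proof.
move=> K_gt0; apply/subsetP => x; rewrite inE => dev_x.
have Ex : x \in E.
  have : x \in (T * T * (T * T))%g.
    apply: dev_lt TV => //; apply: (@leq_ltn_trans (#|T| ^ 2)%N).
      by apply: leq_trans dev_x; rewrite leq_pmull // !muln_gt0 K_gt0 expn_gt0.
    by rewrite -[ltnLHS]mul1n ltn_pmul2r // expn_gt0 T_gt0.
  by apply: subsetP; rewrite !mul_subG.
apply/BohrP; split=> // i si t le_tj; have lini := spec_lin si.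
apply: le_trans (norm_exp_sub1 _ (normC_lin_char lini Ex)) _.
have := spec_dev_close sTE nT TV T1 si Ex dev_x.
rewrite (lin_char1 lini) divr1 distrC expnS natrM -mulrA mulrC -ler_pdivlMr ?ltr0n // => le1.
by apply: le_trans le1; apply: ler_wpM2r => //; rewrite ler_nat leq_exp2l.
Qed.

(** Induction through [splits_sqr]. Starting at index 1 places the pulled back points in [Bohr 2],
    so that their quotients are in [Bohr 0]. *)
Lemma Bohr_splits N : splits N (Bohr 1) (Bohr 3) -> forall j, splits N (Bohr j.+1) (Bohr j.+3).
Proof.
move=> split1; elim=> [//|j IHj]; apply: splits_sqr IHj _ _ => [x /BohrX2 // | x y Bx By].
have [Ex Ey] := (subsetP (Bohr_sub _) x Bx, subsetP (Bohr_sub _) y By).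
apply: Bohr_quotient_sqr => //; apply: Bohr_mul.
  by apply/BohrV/(subsetP (Bohr_mono _) x Bx).
exact: (subsetP (Bohr_mono _) y By).
Qed.

End BohrSets.

Local Close Scope ring_scope.
Local Close Scope group_scope.

(** * The chain of Bohr sets in a nilpotent group *)

Section NormalChain.
Local Open Scope group_scope.

Definition normal_chain (gT : finGroupType) (N : nat) (D : nat -> {set gT}) : Prop :=
  [/\ forall j y, D j :^ y = D j, forall j, (D j)^-1 = D j, forall j, 1 \in D j,
      forall j, D j.+1 * D j.+1 \subset D j & forall j, (#|D j| <= N * #|D j.+1|)%N].

Lemma mulg_subX (gT : finGroupType) (A X Y : {set gT}) m n :
  X \subset A ^+ m -> Y \subset A ^+ n -> X * Y \subset A ^+ (m + n).
Proof. by move=> sX sY; rewrite expgD mulgSS. Qed.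

Lemma splits_sub (gT : finGroupType) N (X D D' : {set gT}) :
  D \subset D' -> splits N X D -> splits N X D'.
Proof.
by move=> sDD' [c [cN cD]]; exists c; split=> // x y Xx Xy /(cD x y Xx Xy)/(subsetP sDD').
Qed.

Lemma almost_periodsJ (gT : finGroupType) (A : {set gT}) n y :
  (forall y, A :^ y = A) -> almost_periods A n :^ y = almost_periods A n.
Proof.
move=> nA; apply/setP => x; rewrite -{1}[x](conjgKV y) memJ_conjg !inE.
by rewrite devJ.
Qed.

Theorem nilpotent_normal_chain (K : nat) : (0 < K)%N -> exists N c : nat,
  forall (gT : finGroupType) (A : {set gT}),
    nilpotent [set: gT] -> 1 \in A -> A^-1 = A -> (forall y, A :^ y = A) ->
    #|A * A * A| <= K * #|A| ->
  exists D : nat -> {set gT},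
    [/\ normal_chain N D, D 0%N \subset A ^+ 32 & (#|A| <= c * #|D 0%N|)%N].
Proof.
(* [c1] is the Croot-Sisask loss and [C] compares A^8 with almost periods. Those of order [n1] lie
   in [E], [K2] is the doubling constant of [T], and almost periods of [T] of order [n2] lie in
   [B 7]. The exponents 7, 15 and 63 come from A^8, A^16 and A^64. *)
move=> K_gt0; pose c1 n := (2 * K ^ (8 * K * n ^ 2))%N.
pose C := (K ^ 7 * c1 (16 * K * 64))%N; pose n1 := (16 * K * (1024 * C).+1)%N.
pose K2 := (K ^ 15 * c1 n1)%N; pose n2 := (8 * K2 * 2 ^ 8)%N.
pose c2 := (2 * K2 ^ (8 * K2 * n2 ^ 2))%N.
exists (K ^ 63 * (c1 n1 * c2))%N, (c1 n1 * c2)%N => gT A nilG A1 AV nA A3.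
have A_gt0 : (0 < #|A|)%N by rewrite card_gt0; apply/set0Pn; exists 1.
have An n (X : {set gT}) : X \subset A ^+ n.+1 -> #|X| <= K ^ n * #|A|.
  by move=> sX; apply: leq_trans (subset_leq_card sX) (card_expgs AV A_gt0 A3 n).
have sA1 : A \subset A ^+ 1 by rewrite expg1.
have sA2 : A * A \subset A ^+ 2 by apply: (@mulg_subX _ A _ _ 1 1).
have sA4 : A * A * (A * A) \subset A ^+ 4 by apply: (@mulg_subX _ A _ _ 2 2).
have A2 : #|A * A| <= K * #|A| by have := An 1%N _ sA2; rewrite expn1.
have Ac n : (0 < n)%N -> (#|A| <= c1 n * #|almost_periods A n|)%N.
  by move=> n_gt0; apply: Croot_Sisask.
have A8 : #|(A * A * (A * A)) * (A * A * (A * A))| <=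
           C * #|almost_periods A (16 * K * 64)|.
  apply: leq_trans (An 7 _ (mulg_subX sA4 sA4)) _.
  by rewrite /C -mulnA leq_mul2l Ac ?orbT // !muln_gt0 K_gt0.
pose H := spec_ker [set: gT] A K.
have nsHG : H <| [set: gT] by apply: spec_ker_normal.
have sH4 : H \subset A ^+ 4 by apply: subset_trans sA4; apply: spec_ker_sub.
have [E [nsEG sHE dE cE]] := nil_self_centralizing_above nilG nsHG.
have n1_gt0 : (0 < n1)%N by rewrite !muln_gt0 K_gt0.
have sSE := almost_periods_sub nA AV A1 K_gt0 A2 A8 nsEG sHE dE cE.
rewrite -/n1 in sSE; set S := almost_periods A n1 in sSE.
have cS : (#|A| <= c1 n1 * #|S|)%N by apply: Ac.
have nS y : S :^ y = S by apply: almost_periodsJ.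
have SV : S^-1 = S by apply/setP => x; rewrite !inE devV.
have sS4 : S \subset A ^+ 4.
  apply: subset_trans sA4; apply/subsetP => x; rewrite inE => dev_x; apply: dev_lt => //.
  apply: (@leq_ltn_trans (#|A| ^ 2)%N); first by apply: leq_trans dev_x; rewrite leq_pmull.
  by rewrite -[ltnLHS]mul1n ltn_pmul2r // expn_gt0 A_gt0.
have nH y : H :^ y = H by apply: (normsP (normal_norm nsHG)); rewrite inE.
have nE y : E :^ y = E by apply: (normsP (normal_norm nsEG)); rewrite inE.
(* Multiplying by [H] makes [T] invariant under [H], as linearity of its large characters
   requires. *)
pose T := S * H.
have nT y : T :^ y = T by rewrite conjsMg nS nH.
have TV : T^-1 = T.
  rewrite invMg SV invGid; apply/normC; apply/subsetP => x _; rewrite inE.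
  by rewrite nS.
have T1 : 1 \in T by rewrite -(mulg1 1) mem_mulg ?group1 // inE dev1 muln0.
have sTE : T \subset E by rewrite mul_subG.
have TH : T * H = T by rewrite /T -mulgA mulGid.
have sT8 : T \subset A ^+ 8 by apply: (@mulg_subX _ A _ _ 4 4).
have leST : (#|S| <= #|T|)%N by apply/subset_leq_card/mulg_subl/group1.
have cT : (#|A| <= c1 n1 * #|T|)%N by apply: leq_trans cS _; rewrite leq_mul2l leST orbT.
have T2 : #|T * T| <= K2 * #|T|.
  apply: leq_trans (An 15 _ (@mulg_subX _ A _ _ 8 8 sT8 sT8)) _.
  by rewrite /K2 -mulnA leq_mul2l cT orbT.
have T_gt0 : (0 < #|T|)%N by rewrite card_gt0; apply/set0Pn; exists 1.
have K2_gt0 : (0 < K2)%N by rewrite !muln_gt0 !expn_gt0 K_gt0.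
have nsHE : H <| E by apply: normalS sHE (subsetT _) nsHG.
pose B := Bohr E T K2.
have BJ j y : B j :^ y = B j by apply: BohrJ.
have BV j : (B j)^-1 = B j.
  apply/setP => x; rewrite mem_invg; apply/idP/idP => /BohrV //.
  by rewrite invgK.
have B1 j : 1 \in B j by apply: Bohr1 nsHE nH dE TH _.
have BM j : B j.+2 * B j.+2 \subset B j.
  by apply/subsetP => _ /mulsgP[x y Bx By ->]; apply: (Bohr_mul sTE T1 nsHE nH dE TH).
have mono j l : (j <= l)%N -> B l \subset B j by apply: Bohr_mono.
have sB32 j : B j \subset A ^+ 32.
  apply: subset_trans (mono 0%N j (leq0n _)) _.
  apply: subset_trans (Bohr0_sub sTE nT TV T1 T2 nsHE nH dE TH) _.
  have sTT := @mulg_subX _ A _ _ 8 8 sT8 sT8.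
  exact: (@mulg_subX _ A _ _ 16 16 sTT sTT).
have cB7 : (#|A| <= c1 n1 * c2 * #|B 7|)%N.
  apply: leq_trans cT _; rewrite -mulnA leq_mul2l; apply/orP; right.
  have n2_gt0 : (0 < n2)%N by rewrite /n2 2!muln_gt0 K2_gt0 expn_gt0.
  apply: leq_trans (Croot_Sisask K2_gt0 T_gt0 T2 n2_gt0) _.
  rewrite leq_mul2l; apply/orP; right; apply: subset_leq_card.
  by apply: (almost_periods_Bohr sTE nT TV T1 nsHE nH dE TH).
(* Differences of [B 7] lie in [B 5], and products of two of these in [B 3]. *)
have spl : splits (K ^ 63 * (c1 n1 * c2)) (B 1%N) (B 3).
  apply: (@splits_sub _ _ _ (B 7 * (B 7)^-1 * (B 7 * (B 7)^-1))).
    by rewrite !BV; apply: subset_trans (BM 3); apply: mulgSS; apply: BM.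
  apply: Ruzsa_covering; first by rewrite card_gt0; apply/set0Pn; exists 1.
  apply: leq_trans (An 63 _ (@mulg_subX _ A _ _ 32 32 (sB32 1%N) (sB32 7))) _.
  by rewrite -mulnA leq_mul2l cB7 orbT.
(* Every second set is kept since a product costs two indices; the start at 1 matches the covering
   estimate. *)
exists (fun j => B j.*2.+1); split; last 2 first.
- exact: sB32.
- by apply: leq_trans cB7 _; rewrite leq_mul2l subset_leq_card ?orbT ?mono.
split=> [j y | j | j | j | j]; rewrite ?doubleS //.
exact: splits_card (Bohr_splits sTE T1 nsHE nH dE TH spl j.*2).
Qed.
End NormalChain.

(** * The metric of a chain *)

Section BirkhoffKakutani.
Local Open Scope group_scope.
Variables (gT : finGroupType) (F : nat -> {set gT}) (n : nat).
Hypotheses (FJ : forall i y, F i :^ y = F i) (FV : forall i, (F i)^-1 = F i).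
Hypotheses (F1 : forall i, 1 \in F i) (F3 : forall i, F i.+1 * F i.+1 * F i.+1 \subset F i).
Hypothesis Fn : F n.+1 = F n.
Implicit Types (x y z : gT) (s : seq gT).

Lemma chain_mono i j : i <= j -> F j \subset F i.
Proof.
move=> /subnK <-; elim: (j - i) => [|k IHk] //; apply: subset_trans IHk.
apply: subset_trans (F3 _); apply/subsetP => x Fx.
by rewrite -(mulg1 x) -(mulg1 x) !mem_mulg.
Qed.

(* The cost of a factor, in units of 2 ^- n. *)
Definition cost x : nat := \max_(i < n.+1 | x \notin F i) 2 ^ (n.+1 - i).

Lemma cost_lt i x : i <= n -> cost x < 2 ^ (n.+1 - i) -> x \in F i.
Proof.
move=> le_in; apply: contraLR => nFx; rewrite -leqNgt.
by have := @leq_bigmax_cond _ (fun i : 'I_n.+1 => x \notin F i)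
     (fun i => (2 ^ (n.+1 - i))%N) (Ordinal (le_in : i < n.+1)) nFx.
Qed.

Lemma cost_le i x : i <= n -> x \in F i -> cost x <= 2 ^ (n - i).
Proof.
move=> le_in Fx; apply/bigmax_leqP => j nFx; rewrite leq_exp2l //.
have lt_ij : i < j.
  by rewrite ltnNge; apply: contra nFx => le_ji; apply: subsetP Fx; apply: chain_mono.
by rewrite -[leqRHS]subSS leq_sub2l.
Qed.
Lemma cost_conj x y : cost (x ^ y) = cost x.
Proof. by apply: eq_bigl => i; rewrite -{1}(FJ i y) memJ_conjg. Qed.

Lemma costV x : cost x^-1 = cost x.
Proof. by apply: eq_bigl => i; rewrite -mem_invg FV. Qed.

(** Finds the first entry at which the accumulated cost passes m / 2; [a] is the cost already
    read. *)
Lemma split_half s m a : 2 * a <= m -> m < 2 * (a + \sum_(z <- s) cost z) ->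
  exists s1 z s2, [/\ s = s1 ++ z :: s2, 2 * (a + \sum_(z <- s1) cost z) <= m
    & m < 2 * (a + \sum_(z <- rcons s1 z) cost z)].
Proof.
elim: s a => [|z s IHs] a le_a; first by rewrite big_nil addn0 ltnNge le_a.
case: (leqP (2 * (a + cost z)) m) => [le_az | lt_az _].
  rewrite big_cons addnA => /(IHs _ le_az)[s1 [z' [s2 [-> le1 lt2]]]].
  by exists (z :: s1), z', s2; rewrite /= !big_cons !addnA.
by exists [::], z, s; rewrite big_nil addn0 big_seq1.
Qed.

(** Cut the product at the entry where the cost passes one half. The two sides have at most half the
    cost and lie in [F i.+1] by induction on the number of factors, and so does the entry itself by
    [cost_lt]; then [F3] applies. Total cost 0 puts all factors in [F n], which is closed under
    products. *)
Lemma prod_cost_lt s i : i <= n -> \sum_(z <- s) cost z < 2 ^ (n - i) ->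
  \prod_(z <- s) z \in F i.
Proof.
have FnM : F n * F n \subset F n.
  rewrite -{1 2}Fn; apply: subset_trans (F3 n); apply/subsetP => x Fx.
  by rewrite -(mulg1 x) mem_mulg.
have zero s' : \sum_(z <- s') cost z = 0%N -> \prod_(z <- s') z \in F n.
  elim: s' => [|z s' IHs]; first by rewrite !big_nil.
  rewrite !big_cons => /eqP; rewrite addn_eq0 => /andP[/eqP z0 /eqP/IHs Fs].
  apply: (subsetP FnM); rewrite mem_mulg // (@cost_lt n) // z0.
  by rewrite expn_gt0.
have [k le_sk] := ubnP (size s); elim: k => // k IHk in s i le_sk *.
move=> le_in lt_s; have [s0 | s_gt0] := posnP (\sum_(z <- s) cost z).
  by apply: subsetP (zero s s0); apply: chain_mono.
have lt_in : i < n.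
  rewrite ltn_neqAle le_in andbT; apply: contraTneq lt_s => ->.
  by rewrite subnn -leqNgt.
set m := \sum_(z <- s) cost z in lt_s s_gt0.
have [||s1 [z [s2 [sE le1 lt2]]]] := @split_half s m 0 => //.
  by rewrite add0n -/m mul2n -addnn -[ltnLHS]addn0 ltn_add2l.
have mE : m = \sum_(z <- s1) cost z + (cost z + \sum_(z <- s2) cost z).
  by rewrite /m sE big_cat big_cons.
move: le_sk; rewrite sE size_cat /= addnS !ltnS => le_sk.
have half a : 2 * a <= m -> a < 2 ^ (n - i.+1).
  move=> le_am; rewrite -(ltn_pmul2l (isT : 0 < 2)) -expnS -subSn // subSS.
  exact: leq_ltn_trans lt_s.
rewrite add0n in le1 lt2; rewrite big_cat big_cons /= mulgA; apply: (subsetP (F3 i)).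
rewrite mem_mulg ?mem_mulg //.
- by apply: IHk => //; [apply: leq_ltn_trans le_sk; rewrite leq_addr | exact: half].
- apply: cost_lt => //; rewrite subSS; apply: leq_ltn_trans lt_s.
  by rewrite mE addnCA leq_addr.
apply: IHk => //; first by apply: leq_trans le_sk; rewrite ltnS leq_addl.
apply: half; move: lt2; rewrite mE -cats1 big_cat big_seq1.
move: (\sum_(z <- s1) _) (cost z) (\sum_(z <- s2) _) => a b c.
rewrite !mul2n -!addnn [X in X < _]addnA ltn_add2l => lt2.
by rewrite addnA [X in _ <= X]addnC leq_add2l ltnW.
Qed.

Let reachable x m := exists s, \prod_(z <- s) z = x /\ \sum_(z <- s) cost z = m.

Let reachableE x : exists m, `[< reachable x m >].
Proof. by exists (cost x); apply/asboolP; exists [:: x]; rewrite !big_seq1. Qed.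

(** The least total cost of a factorization of [x]; it is attained because costs are natural
    numbers. *)
Definition length x : nat := ex_minn (reachableE x).

Lemma lengthP x : exists s, \prod_(z <- s) z = x /\ \sum_(z <- s) cost z = length x.
Proof. by rewrite /length; case: ex_minnP => m /asboolP. Qed.

Lemma length_min s : length (\prod_(z <- s) z) <= \sum_(z <- s) cost z.
Proof.
by rewrite /length; case: ex_minnP => m _; apply; apply/asboolP; exists s.
Qed.

Lemma length1 : length 1 = 0%N.
Proof. by apply/eqP; have := length_min [::]; rewrite !big_nil leqn0. Qed.

Lemma lengthM x y : length (x * y) <= length x + length y.
Proof.
have [[s [<- <-]] [t [<- <-]]] := (lengthP x, lengthP y).
by rewrite -!big_cat length_min.
Qed.

Lemma lengthV x : length x^-1 = length x.
Proof.
suff le_V y : length y^-1 <= length y by apply/eqP; rewrite eqn_leq le_V -{1}[x]invgK le_V.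
have [s [<- <-]] := lengthP y; elim: s => [|z s IHs].
  by rewrite !big_nil invg1 length1.
rewrite !big_cons invMg addnC; apply: leq_trans (lengthM _ _) (leq_add IHs _).
by have := length_min [:: z^-1]; rewrite !big_seq1 costV.
Qed.

Lemma lengthJ x y : length (x ^ y) = length x.
Proof.
suff le_J u v : length (u ^ v) <= length u.
  by apply/eqP; rewrite eqn_leq le_J -{1}(conjgK y x) le_J.
have [s [<- <-]] := lengthP u; elim: s => [|z s IHs].
  by rewrite !big_nil conj1g length1.
rewrite !big_cons conjMg; apply: leq_trans (lengthM _ _) (leq_add _ IHs).
by have := length_min [:: z ^ v]; rewrite !big_seq1 cost_conj.
Qed.

Lemma length_le i x : i <= n -> x \in F i -> length x <= 2 ^ (n - i).
Proof.
move=> le_in Fx; have := length_min [:: x]; rewrite !big_seq1 => /leq_trans; apply.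
exact: cost_le.
Qed.

Lemma length_eq0 x : x \in F n -> length x = 0%N.
Proof.
move=> Fx; apply/eqP; rewrite -leqn0; have := length_min [:: x]; rewrite !big_seq1.
move=> /leq_trans; apply; apply/bigmax_leqP => i /negP[].
by apply: subsetP Fx; apply: chain_mono; rewrite -ltnS.
Qed.

Lemma length_lt i x : i <= n -> length x < 2 ^ (n - i) -> x \in F i.
Proof. by have [s [<- <-]] := lengthP x; apply: prod_cost_lt. Qed.
End BirkhoffKakutani.

From Stdlib Require Import Reals Lra.

Section ChainMetric.
Variables (gT : finGroupType) (F : nat -> {set gT}) (M : nat).
Hypotheses (FJ : forall i y, (F i :^ y = F i)%g) (FV : forall i, ((F i)^-1 = F i)%g).
Hypotheses (F1 : forall i, 1%g \in F i) (F3 : forall i, (F i.+1 * F i.+1 * F i.+1 \subset F i)%g).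
Hypotheses (FM : forall i, #|F i| <= M * #|F i.+1|).

Lemma chain_stabilizes m : exists2 n, m <= n & F n.+1 = F n.
Proof.
have [k] := ubnP #|F m|; elim: k m => // k IHk m lt_k.
have sF : F m.+1 \subset F m by apply: chain_mono.
have [/eqP E | neF] := boolP (F m.+1 == F m); first by exists m.
have [|n le_mn Fn] := IHk m.+1; last by exists n => //; apply: ltnW.
have lt_F : #|F m.+1| < #|F m| by apply: proper_card; rewrite properEneq neF.
by rewrite ltnS in lt_k; apply: leq_trans lt_F _.
Qed.

Lemma INR_leq m n : m <= n -> (INR m <= INR n)%R.
Proof. by move/ssrnat.leP/le_INR. Qed.

Lemma INR_expn m n : INR (expn m n) = (INR m ^ n)%R.
Proof. by elim: n => [|n IHn] //=; rewrite expnS -multE mult_INR IHn. Qed.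

Lemma INR_exp2 n : INR (expn 2 n) = (2 ^ n)%R.
Proof. by rewrite INR_expn /=; congr pow; lra. Qed.

Lemma leq_Rpower2 n : (INR n <= Rpower 2 (INR n))%R.
Proof.
rewrite Rpower_pow; last lra.
by rewrite -INR_exp2; apply: INR_leq; apply: ltnW; apply: ltn_expl.
Qed.

Lemma dyadic_scale (r : R) k : (1 <= r)%R -> (r <= 2 ^ k)%R ->
  exists2 j, j <= k & (2 ^ j <= r < 2 ^ j.+1)%R.
Proof.
move=> r1; elim: k => [|k IHk] rk.
  by exists 0 => //=; move: rk => /=; lra.
have [le_rk | lt_kr] := Rle_lt_dec r (2 ^ k).
  by have [j le_jk rj] := IHk le_rk; exists j => //; apply: ltnW.
have [lt_rk | le_kr] := Rlt_le_dec r (2 ^ k.+1); first by exists k => //; lra.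
exists k.+1 => //; have : (0 < 2 ^ k.+1)%R by apply: pow_lt; lra.
by move: rk le_kr => /=; lra.
Qed.

Lemma exists_chain_metric : exists (rho : gT -> gT -> R) (delta : R),
  [/\ pseudo_metric rho, bi_invariant rho, dimensional_ball rho delta (INR (M * M)),
      F 3 \subset rball rho delta & rball rho delta \subset F 2].
Proof.
(* Stopping at n >= 3 leaves room for the radius 2^(n-3), whose ball lies between [F 3] and
   [F 2]. *)
have [n le3n Fn] := chain_stabilizes 3.
pose len := length F n.
have lenM := lengthM F n.
have lenV x : len x^-1%g = len x by apply: lengthV.
have lenJ x y : len (x ^ y)%g = len x by apply: lengthJ.
pose rho x y := INR (len (x^-1 * y)%g).
have ballP r x : reflect (INR (len x) <= r)%R (x \in rball rho r).
  rewrite inE /rho mulg1 lenV; case: Rle_dec => h; by [apply: ReflectT | apply: ReflectF].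
have sub_ball i r : i <= n -> (INR (expn 2 (n - i)) <= r)%R -> F i \subset rball rho r.
  move=> le_in le_r; apply/subsetP => x Fx; apply/ballP; apply: Rle_trans le_r.
  by apply: INR_leq; apply: length_le.
have ball_sub i r : i <= n -> (r < INR (expn 2 (n - i)))%R -> rball rho r \subset F i.
  move=> le_in lt_r; apply/subsetP => x /ballP le_x.
  apply: (length_lt F1 F3 Fn) => //; apply/ssrnat.ltP/INR_lt; exact: Rle_lt_trans lt_r.
exists rho, (2 ^ (n - 3))%R; have delta_gt0 : (0 < 2 ^ (n - 3))%R by apply: pow_lt; lra.
split.
- split; first by move=> x y; apply: pos_INR.
  split; first by move=> x; rewrite /rho mulVg /len length1.
  split=> [x y | x y z]; first by rewrite /rho -lenV invMg invgK.
  rewrite /rho -plus_INR plusE; apply: INR_leq.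
  by rewrite -[(x^-1 * z)%g](_ : (x^-1 * y * (y^-1 * z))%g = _) ?lenM // mulgA mulgK.
- move=> x y z; rewrite /rho; split; first by rewrite invMg -mulgA mulKg.
  by rewrite -(lenJ (x^-1 * y)%g z) conjgE invMg !mulgA.
- split=> // r r_gt0 le_r.
  have cardM (X Y : {set gT}) i : X \subset F i -> F i.+2 \subset Y ->
      (INR #|X| <= Rpower 2 (INR (M * M)) * INR #|Y|)%R.
    move=> sX sY; apply: Rle_trans (_ : INR (M * M) * INR #|Y| <= _)%R; last first.
      by apply: Rmult_le_compat_r; [exact: pos_INR | exact: leq_Rpower2].
    rewrite -mult_INR multE; apply: INR_leq; apply: leq_trans (subset_leq_card sX) _.
    apply: leq_trans (FM i) _; rewrite -mulnA leq_mul2l; apply/orP; right.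
    apply: leq_trans (FM i.+1) _; rewrite leq_mul2l; apply/orP; right.
    exact: subset_leq_card.
  (* Lengths are integers: below radius 1 the ball contains the zero-length set [F n], while the
     doubled ball has lengths below 2. *)
  have [r1 | r1] := Rlt_le_dec r 1.
    apply: (@cardM _ _ (n - 1)).
      apply: ball_sub; first exact: leq_subr.
      by rewrite subKn ?(leq_trans _ le3n) //= ; lra.
    apply/subsetP => x Fx; apply/ballP; rewrite /len (length_eq0 F1 F3) //=; first lra.
    apply: subsetP Fx; apply: chain_mono => //.
    by rewrite subn1 prednK ?(leq_trans _ le3n).
  (* With 2^j <= r < 2^(j+1), the ball of radius 2r lies in [F (n - j.+2)] and that of radius r
     contains [F (n - j)], two steps further down. *)
  have [j le_j [le_jr lt_rj]] := dyadic_scale r1 le_r.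
  have le_jn : j + 3 <= n by rewrite -(subnK le3n) leq_add2r.
  have le_jn2 : j.+2 <= n by apply: leq_trans le_jn; rewrite addnS addn2.
  apply: (@cardM _ _ (n - j.+2)).
    apply: ball_sub; first exact: leq_subr.
    by rewrite subKn // INR_exp2; move: lt_rj => /=; lra.
  rewrite (_ : (n - j.+2).+2 = n - j); last by rewrite -subSn // -subSn ?subSS // ltnW.
  apply: sub_ball; first exact: leq_subr.
  by rewrite subKn ?INR_exp2 // (leq_trans _ le_jn2) // ltnW.
- by apply: sub_ball => //; rewrite INR_exp2; apply: Rle_refl.
apply: ball_sub; first exact: ltnW.
rewrite -INR_exp2; apply/lt_INR/ssrnat.ltP; rewrite ltn_exp2l // -subSn //.
Qed.

End ChainMetric.

(** * Completion of the chain by powers of A, and the theorem *)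

Section CompletedChain.
Variables (gT : finGroupType) (A : {set gT}) (N c K : nat) (D : nat -> {set gT}).
Hypotheses (K_gt0 : 0 < K) (A1 : 1%g \in A) (AV : (A^-1)%g = A) (nA : forall y, (A :^ y)%g = A).
Hypotheses (A3 : (#|A * A * A| <= K * #|A|)%g) (chainD : normal_chain N D).
Hypotheses (sDA : (D 0 \subset A ^+ 32)%g) (cD : #|A| <= c * #|D 0|).

(* Only every second D is kept, so that threefold products step down a single level; the powers
   of A at the top make A a subset of the ball and keep the ball of twice the radius small. *)
Definition completed_chain i : {set gT} :=
  if i < 4 then (A ^+ (muln 128 (expn 3 (3 - i))))%g else D (i - 4).*2.
Local Notation F := completed_chain.

(** The first summand pays for the steps among powers of [A] and down to [D 0], the second for two
    steps of [D] at once. *)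
Definition chain_constant : nat := muln (expn K (muln 128 (expn 3 3))) c.+1 + muln N N.

Let A_gt0 : 0 < #|A|. Proof. by rewrite card_gt0; apply/set0Pn; exists 1%g. Qed.

Lemma sub_expg_leq m n : m <= n -> (A ^+ m \subset A ^+ n)%g.
Proof.
move/subnK <-; rewrite expgD; apply: mulg_subr; elim: (n - m) => [|k IHk]; first by rewrite inE.
by rewrite expgS -(mulg1 1%g) mem_mulg.
Qed.

Lemma expg_normal n y : ((A ^+ n) :^ y)%g = (A ^+ n)%g.
Proof. by elim: n => [|n IHn]; rewrite ?conjs1g // expgS conjsMg nA IHn. Qed.

Lemma expg_inv n : ((A ^+ n)^-1)%g = (A ^+ n)%g.
Proof. by elim: n => [|n IHn]; rewrite ?invg1 // {1}expgSr invMg AV IHn -expgS. Qed.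

Lemma card_expg n : #|(A ^+ n)%g| <= expn K n * #|A|.
Proof.
apply: leq_trans (card_expgs AV A_gt0 A3 n); apply: subset_leq_card.
exact: sub_expg_leq.
Qed.

Lemma completed_chainJ i y : (F i :^ y)%g = F i.
Proof. by rewrite /F; case: ifP => _; [apply: expg_normal | case: chainD]. Qed.

Lemma completed_chainV i : ((F i)^-1)%g = F i.
Proof. by rewrite /F; case: ifP => _; [apply: expg_inv | case: chainD]. Qed.

Lemma completed_chain1 i : 1%g \in F i.
Proof.
rewrite /F; case: ifP => _; last by case: chainD.
by apply: (subsetP (sub_expg_leq (leq0n _))); rewrite inE.
Qed.

Lemma completed_chainM i : (F i.+1 * F i.+1 * F i.+1 \subset F i)%g.
Proof.
have [_ _ D1 DM _] := chainD.
rewrite /F; case: (ltngtP i 3) => [lt_i3 | lt_3i | ->].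
- rewrite [i < 4]ltnW // [i.+1 < 4]lt_i3 -(subnSK lt_i3) expnS mulnCA -!expgD.
  by move: (muln 128 _) => m; rewrite !mulSn mul0n addn0 addnA.
- have -> : (i.+1 < 4) = false by rewrite ltnNge ltnW.
  have -> : (i < 4) = false by rewrite ltnNge lt_3i.
  rewrite subSn // doubleS; apply: subset_trans (DM _).
  apply: mulgSS; first exact: DM.
  apply: subset_trans (DM _); apply/subsetP => x Dx.
  by rewrite -(mulg1 x) mem_mulg.
(* At the junction three copies of [D 0] lie in A^96, inside A^128. *)
rewrite !subnn expn0 muln1 /=; apply: subset_trans (sub_expg_leq (isT : 32 + 32 + 32 <= 128)).
by rewrite !expgD !mulgSS.
Qed.

Lemma completed_chain_card i : #|F i| <= chain_constant * #|F i.+1|.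
Proof.
have [_ _ _ _ DN] := chainD.
have card_top i' : i' < 4 -> #|F i'| <= expn K (muln 128 (expn 3 3)) * #|A|.
  move=> lt_i4; rewrite /F lt_i4; apply: leq_trans (card_expg _) _.
  rewrite leq_mul2r; apply/orP; right; apply: leq_pexp2l => //.
  by rewrite leq_mul2l leq_exp2l // leq_subr orbT.
have [lt_i4 | le_4i] := ltnP i 4; last first.
  have -> : F i = D (i - 4).*2 by rewrite /F (leq_gtF le_4i).
  have -> : F i.+1 = D (i - 4).*2.+2 by rewrite /F (leq_gtF (leqW le_4i)) subSn.
  apply: leq_trans (DN _) _; apply: leq_trans (leq_mul (leqnn N) (DN _)) _.
  by rewrite mulnA leq_mul2r leq_addl orbT.
apply: leq_trans (card_top i lt_i4) _.
apply: leq_trans (_ : muln (expn K (muln 128 (expn 3 3))) c.+1 * #|F i.+1| <= _); last first.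
  by rewrite leq_mul2r leq_addr orbT.
rewrite -mulnA leq_mul2l; apply/orP; right; move: lt_i4.
rewrite ltnS leq_eqVlt => /orP[/eqP -> | lt_i3].
  by apply: leq_trans cD _; rewrite /F /= leq_mul2r leqnSn orbT.
rewrite /F [i.+1 < 4]lt_i3; apply: leq_trans (leq_pmull _ (ltn0Sn c)).
rewrite -{1}(expg1 A); apply/subset_leq_card/sub_expg_leq.
by rewrite muln_gt0 expn_gt0.
Qed.
End CompletedChain.

Theorem theorem1p4 :
  forall K : R, (1 <= K)%R ->
  exists C1 C2 : R, (0 < C1)%R /\ (0 < C2)%R /\
  forall (gT : finGroupType) (A : {set gT}),
    nilpotent [set: gT] ->
    (1%g \in A) ->
    (A^-1)%g = A ->
    (forall x : gT, (x *: A)%g = (A :* x)%g) ->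
    (INR #|(A * A * A)%g| <= K * INR #|A|)%R ->
    exists (rho : gT -> gT -> R) (delta : R),
      pseudo_metric rho /\ bi_invariant rho /\ (0 < delta)%R /\
      dimensional_ball rho delta C1 /\
      A \subset rball rho delta /\
      (INR #|rball rho delta| <= C2 * INR #|A|)%R.
Proof.
move=> K K1; have [n ltKn] := INR_unbounded K.
have n_gt0 : 0 < n by apply/ssrnat.ltP/INR_lt; move: ltKn => /=; lra.
have [N [c chainP]] := nilpotent_normal_chain n_gt0.
pose M := chain_constant N c n; pose C2 := expn n (muln 128 (expn 3 3)).
have C2_gt0 : 0 < C2 by rewrite expn_gt0 n_gt0.
have M_gt0 : 0 < M by rewrite addn_gt0 muln_gt0 C2_gt0.
have INR_gt0 k : 0 < k -> (0 < INR k)%R by move/ssrnat.ltP/lt_0_INR.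
exists (INR (muln M M)), (INR C2); split; first by apply: INR_gt0; rewrite muln_gt0 M_gt0.
split; first exact: INR_gt0.
move=> gT A nilG A1 AV xA A3R.
have nA y : (A :^ y)%g = A by rewrite conjsgE -xA lcosetK.
have A3 : (#|A * A * A| <= n * #|A|)%g.
  apply/ssrnat.leP/INR_le; rewrite -multE mult_INR; apply: Rle_trans A3R _.
  by apply: Rmult_le_compat_r; [exact: pos_INR | lra].
have [D [chainD sDA cD]] := chainP gT A nilG A1 AV nA A3.
have [rho [delta [mrho birho ball sF sB]]] := @exists_chain_metric gT (completed_chain A D) M
  (completed_chainJ nA chainD) (completed_chainV AV chainD) (completed_chain1 A1 chainD)
  (completed_chainM A1 chainD sDA) (completed_chain_card n_gt0 A1 AV A3 chainD cD).
exists rho, delta; do 2![split=> //]; split; first by case: ball.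
split=> //; split.
  (* [F 3] is A^128, which contains [A]; the ball lies in [F 2], which is A^384. *)
  by apply: subset_trans sF; rewrite -{1}(expg1 A); apply: sub_expg_leq.
rewrite -mult_INR multE; apply: INR_leq; apply: leq_trans (subset_leq_card sB) _.
apply: leq_trans (card_expg A1 AV A3 _) _.
rewrite leq_mul2r; apply/orP; right; apply: leq_pexp2l => //.
Qed.
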